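(* Let $X$ be a complete median space of finite rank and let $\Gamma\curvearrowright X$ be an isometric action that is Roller minimal and without wall inversions. The following are equivalent: \begin{enumerate} \item $X$ is irreducible; \item there exists a pair of strongly separated halfspaces; \item for every thick halfspace $\mathfrak h$, there exist halfspaces $\mathfrak h'\subseteq\mathfrak h\subseteq\mathfrak h''$ such that $\mathfrak h'$ and $\mathfrak h''^*$ are thick and strongly separated. \end{enumerate}
   Context: A median space is a metric space $(X,d)$ in which for all $x,y,z$ the set $I(x,y)\cap I(y,z)\cap I(z,x)$ is a single point, where $I(x,y)=\{z:d(x,z)+d(z,y)=d(x,y)\}$; convex sets contain $I(x,y)$ whenever they contain $x,y$. A halfspace is a nonempty proper convex $\mathfrak h\subseteq X$ with convex complement $\mathfrak h^*$; $\mathscr H$ is the set of halfspaces. $\mathfrak h,\mathfrak k$ are transverse if $\mathfrak h\cap\mathfrak k,\mathfrak h\cap\mathfrak k^*,\mathfrak h^*\cap\mathfrak k,\mathfrak h^*\cap\mathfrak k^*$ are all nonempty; rank is the maximal size of a set of pairwise transverse halfspaces. A halfspace $\mathfrak h$ is thick if both $\mathfrak h$ and $\mathfrak h^*$ have nonempty interior. Halfspaces $\mathfrak h,\mathfrak k$ are strongly separated if $\overline{\mathfrak h}\cap\overline{\mathfrak k}=\emptyset$ (closures in $X$) and no halfspace is transverse to both. $X$ is irreducible if it is not isometric to an $\ell^1$-product $X_1\times X_2$ of two median spaces each with at least two points. The action is without wall inversions if $g\mathfrak h\neq\mathfrak h^*$ for all $g\in\Gamma,\mathfrak h\in\mathscr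 H$. Roller compactification: with $\sigma_x=\{\mathfrak h:x\in\mathfrak h\}$, $\mathscr H(x|y)=\sigma_y\setminus\sigma_x$, and ultrafilters the maximal sets of pairwise intersecting halfspaces, there is a canonical isometry-invariant measure $\widehat\nu$ on a $\sigma$-algebra $\widehat{\mathscr B}$ on $\mathscr H$ with $\widehat\nu(\mathscr H(x|y))=d(x,y)$; $\overline X$ is the set of ultrafilters $\sigma$ with $\sigma\triangle\sigma_x\in\widehat{\mathscr B}$ modulo null symmetric difference, with median $m(\sigma_1,\sigma_2,\sigma_3)=(\sigma_1\cap\sigma_2)\cup(\sigma_2\cap\sigma_3)\cup(\sigma_3\cap\sigma_1)$ and the coarsest topology making all projections $\overline X\to I(x,y)$ continuous; it is a compact median algebra containing $X$. A subset $C$ of $\overline X$ is convex if $m(a,b,c)\in C$ for all $a,b\in C$, $c\in\overline X$. The action is Roller minimal if $X$ is not a single point and $\Gamma$ preserves no proper, nonempty, closed, convex subset of $\overline X$. *)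

(* Defs.v *)
From HB Require Import structures.
From mathcomp Require Import all_boot all_order all_algebra.
From mathcomp Require Import all_classical all_reals all_analysis.
Set Implicit Arguments. Unset Strict Implicit. Unset Printing Implicit Defensive.
Import Order.TTheory GRing.Theory Num.Theory.
Local Open Scope classical_set_scope.
Local Open Scope ring_scope.

Section MedianDefs.
Context {R : realType} {X : Type} (d : X -> X -> R).

Definition is_metric : Prop :=
  [/\ forall x y, d x y = 0 <-> x = y,
      forall x y, d x y = d y x &
      forall x y z, d x z <= d x y + d y z].

Definition interval (x y : X) : set X := [set z | d x z + d z y = d x y].

Definition median_space : Prop :=
  is_metric /\
  forall x y z, exists! m, interval x y m /\ interval y z m /\ interval z x m.

Definition complete_space : Prop :=
  forall u : nat -> X,
    (forall e : R, 0 < e -> exists N, forall m n, (N <= m)%N -> (N <= n)%N ->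
        d (u m) (u n) < e) ->
    exists l, forall e : R, 0 < e -> exists N, forall n, (N <= n)%N -> d (u n) l < e.

Definition convex (C : set X) : Prop :=
  forall x y, C x -> C y -> interval x y `<=` C.

Definition halfspace (h : set X) : Prop :=
  [/\ h !=set0, ~` h !=set0, convex h & convex (~` h)].

Definition transverse (h k : set X) : Prop :=
  [/\ h `&` k !=set0, h `&` ~` k !=set0, ~` h `&` k !=set0 & ~` h `&` ~` k !=set0].

Definition finite_rank : Prop :=
  exists n : nat, forall (k : nat) (f : nat -> set X),
    (forall i, (i < k)%N -> halfspace (f i)) ->
    (forall i j, (i < k)%N -> (j < k)%N -> i <> j -> transverse (f i) (f j)) ->
    (k <= n)%N.

Definition closure_X (A : set X) : set X :=
  [set x | forall e : R, 0 < e -> exists y, A y /\ d x y < e].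
Definition interior_X (A : set X) : set X :=
  [set x | exists e : R, 0 < e /\ forall y, d x y < e -> A y].

Definition thick (h : set X) : Prop :=
  [/\ halfspace h, interior_X h !=set0 & interior_X (~` h) !=set0].

Definition strongly_separated (h k : set X) : Prop :=
  [/\ halfspace h, halfspace k, closure_X h `&` closure_X k = set0 &
      ~ exists j, [/\ halfspace j, transverse j h & transverse j k]].

Definition HS : set (set X) := [set h | halfspace h].
Definition sigma_pt (x : X) : set (set X) := [set h | halfspace h /\ h x].
Definition hsi (x y : X) : set (set X) := sigma_pt y `\` sigma_pt x.
Definition Bsig : set (set (set X)) :=
  <<s HS, [set E | exists x y, E = hsi x y] >>.

Definition symdiff (A B : set (set X)) : set (set X) := (A `\` B) `|` (B `\` A).

Definition wall_measure (nu : set (set X) -> \bar R) : Prop :=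
  [/\ nu set0 = 0%E,
      forall A, Bsig A -> (0 <= nu A)%E,
      forall F : nat -> set (set X), (forall i, Bsig (F i)) -> trivIset setT F ->
        ((fun n => \sum_(0 <= i < n) nu (F i))%E @ \oo --> nu (\bigcup_n F n)) &
      forall x y, nu (hsi x y) = (d x y)%:E].

Definition Bhat : set (set (set X)) :=
  [set E | E `<=` HS /\ forall x y, Bsig (E `&` hsi x y)].
Definition nuhat (nu : set (set X) -> \bar R) (E : set (set X)) : \bar R :=
  ereal_sup [set nu (E `&` hsi x y) | x in setT & y in setT].

Definition ultrafilter (s : set (set X)) : Prop :=
  [/\ s `<=` HS,
      forall h k, s h -> s k -> h `&` k !=set0 &
      forall t, t `<=` HS -> (forall h k, t h -> t k -> h `&` k !=set0) ->
        s `<=` t -> t = s].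

Definition in_Xbar (s : set (set X)) : Prop :=
  ultrafilter s /\ exists x, Bhat (symdiff s (sigma_pt x)).

Definition Xbar_eq (nu : set (set X) -> \bar R) (s t : set (set X)) : Prop :=
  nuhat nu (symdiff s t) = 0%E.

Definition medianU (a b c : set (set X)) : set (set X) :=
  (a `&` b) `|` (b `&` c) `|` (c `&` a).

Definition proj (nu : set (set X) -> \bar R) (x y : X) (s : set (set X)) (z : X) : Prop :=
  interval x y z /\ Xbar_eq nu (medianU (sigma_pt x) (sigma_pt y) s) (sigma_pt z).

(** closedness in the coarsest topology making all projections continuous:
    each point outside C has a basic neighbourhood disjoint from C *)
Definition Xbar_closed (nu : set (set X) -> \bar R) (C : set (set (set X))) : Prop :=
  forall s, in_Xbar s -> ~ C s ->
    exists (n : nat) (xs ys : nat -> X) (e : R), 0 < e /\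
      forall t, in_Xbar t ->
        (forall i, (i < n)%N -> exists z z',
            [/\ proj nu (xs i) (ys i) s z, proj nu (xs i) (ys i) t z' & d z z' < e]) ->
        ~ C t.

Definition Xbar_convex (C : set (set (set X))) : Prop :=
  forall a b c, C a -> C b -> in_Xbar c -> C (medianU a b c).

Definition Xbar_subset (nu : set (set X) -> \bar R) (C : set (set (set X))) : Prop :=
  C `<=` in_Xbar /\ forall s t, C s -> in_Xbar t -> Xbar_eq nu s t -> C t.

Definition isometric_action (G : Type) (mul : G -> G -> G) (one : G) (inv : G -> G)
  (act : G -> X -> X) : Prop :=
  [/\ (forall a b c, mul a (mul b c) = mul (mul a b) c),
      (forall a, mul one a = a) /\ (forall a, mul (inv a) a = one),
      (forall x, act one x = x),
      (forall a b x, act (mul a b) x = act a (act b x)) &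
      (forall a x y, d (act a x) (act a y) = d x y)].

Definition act_hs (G : Type) (act : G -> X -> X) (g : G) (s : set (set X)) : set (set X) :=
  (fun h => act g @` h) @` s.

Definition roller_minimal (G : Type) (act : G -> X -> X) (nu : set (set X) -> \bar R) : Prop :=
  (exists x y : X, x <> y) /\
  forall C : set (set (set X)),
    Xbar_subset nu C -> Xbar_closed nu C -> Xbar_convex C ->
    (forall g s, C s -> C (act_hs act g s)) ->
    C !=set0 -> forall s, in_Xbar s -> C s.

Definition without_wall_inversions (G : Type) (act : G -> X -> X) : Prop :=
  forall g h, halfspace h -> act g @` h <> ~` h.

Definition has_strongly_separated_pair : Prop :=
  exists h k, strongly_separated h k.

Definition thick_nested_ss : Prop :=
  forall h, thick h -> exists h' h'',
    [/\ h' `<=` h, h `<=` h'', thick h', thick (~` h'') & strongly_separated h' (~` h'')].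

End MedianDefs.

Definition irreducible {R : realType} {X : Type} (d : X -> X -> R) : Prop :=
  ~ exists (X1 X2 : Type) (d1 : X1 -> X1 -> R) (d2 : X2 -> X2 -> R) (f : X -> X1 * X2),
      [/\ bijective f,
          forall x y, d x y = d1 (f x).1 (f y).1 + d2 (f x).2 (f y).2,
          median_space d1 /\ median_space d2,
          exists a b : X1, a <> b &
          exists a b : X2, a <> b].

(* Main.v *)
(** Minimality makes every thick halfspace [h] flippable: if all translates of its
closure met, the points of the Roller compactification lying in all of them would form
a proper closed convex invariant set. It is nonempty because the limit of the gates of
a base point is a measurable ultrafilter, by finite rank. Flipping twice gives double
skewering.

Suppose no two thick halfspaces with disjoint closures are strongly separated. Among
such pairs [(a, b)] choose one minimizing the rank of the set [T] of thick halfspaces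
transverse to both. Skewering shows that if one of the four sectors of two transverse
thick halfspaces contains a thick halfspace, then so do two opposite sectors; for a
sector of [j] in [T] and [a] this would produce a pair whose crossing halfspaces are
all transverse to [j], contradicting minimality. Hence every thick halfspace not
transverse to an element of [T] is in [T], so the thick halfspaces split into two
mutually transverse classes and [X] is a product. Conversely a halfspace of a product
depends on one coordinate only, so a product has no strongly separated pair; and a
thick strongly separated pair is moved around a given thick halfspace by skewering. *)
Require Import Defs.
From mathcomp Require Import all_boot all_order all_algebra.
From mathcomp Require Import all_classical all_reals all_analysis.
From mathcomp Require Import lra.
Set Implicit Arguments. Unset Strict Implicit. Unset Printing Implicit Defensive.
Import Order.TTheory GRing.Theory Num.Theory.
Local Open Scope classical_set_scope.
Local Open Scope ring_scope.

Definition invS {R : realType} (n : nat) : R := n.+1%:R^-1.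

Lemma invS_gt0 (R : realType) n : 0 < invS n :> R.
Proof. by rewrite invr_gt0. Qed.

Lemma invS_lt (R : realType) (e : R) : 0 < e ->
  exists N, forall n, (N <= n)%N -> invS n < e.
Proof.
move=> e0; have := near_infty_natSinv_lt (PosNum e0).
by case=> N _ /= H; exists N => n Nn; exact: H.
Qed.

Lemma setNE (T : Type) (A : set T) x : (~` A) x = ~ A x.
Proof. by []. Qed.

(** * Intervals, medians, convex sets and halfspaces *)

Section MedianGeometry.
Context {R : realType} {X : Type} (d : X -> X -> R).
Hypothesis ms : median_space d.
Implicit Types (x y z u v w p q : X) (h C K : set X).

Local Notation I := (Defs.interval d).
Local Notation cl := (Defs.closure_X d).
Local Notation halfspace := (Defs.halfspace d).
Local Notation convex := (Defs.convex d).

Lemma dxx x : d x x = 0.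
Proof. by have [[H _ _] _] := ms; apply/H. Qed.

Lemma dC x y : d x y = d y x.
Proof. by have [[_ H _] _] := ms; exact: H. Qed.

Lemma dT y x z : d x z <= d x y + d y z.
Proof. by have [[_ _ H] _] := ms; exact: H. Qed.

Lemma d_eq0 x y : d x y = 0 -> x = y.
Proof. by have [[H _ _] _] := ms => /H. Qed.

Lemma d_ge0 x y : 0 <= d x y.
Proof. have := dT y x x; rewrite dxx (dC y x); lra. Qed.

Lemma d_gt0 x y : x <> y -> 0 < d x y.
Proof.
move=> xy; rewrite lt_neqAle d_ge0 andbT eq_sym; apply/eqP => /d_eq0.
exact: xy.
Qed.

Lemma itvC x y z : I x y z -> I y x z.
Proof. by rewrite /Defs.interval /= (dC y z) (dC z x) (dC y x); lra. Qed.

Lemma itvl x y : I x y x.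
Proof. by rewrite /Defs.interval /= dxx add0r. Qed.

Lemma itvr x y : I x y y.
Proof. by rewrite /Defs.interval /= dxx addr0. Qed.

Lemma itv_trans x y z w : I x y z -> I x z w -> I x y w /\ I w y z.
Proof.
rewrite /Defs.interval /= => H1 H2.
have := dT z w y; have := dT w x y; split; lra.
Qed.

(** The default [x] only makes the function total; [medP] excludes it. *)
Definition med x y z : X :=
  if pselect (exists m, I x y m /\ I y z m /\ I z x m) is left e
  then projT1 (cid e) else x.

Lemma medP x y z : [/\ I x y (med x y z), I y z (med x y z) & I z x (med x y z)].
Proof.
rewrite /med; case: pselect => [e|[]].
  by case: (cid e) => /= m [? [? ?]].
by have [_ /(_ x y z) [m [Hm _]]] := ms; exists m.
Qed.

Lemma medI1 x y z : I x y (med x y z). Proof. by have [] := medP x y z. Qed.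
Lemma medI2 x y z : I y z (med x y z). Proof. by have [] := medP x y z. Qed.
Lemma medI3 x y z : I x z (med x y z).
Proof. by have [_ _ /itvC] := medP x y z. Qed.

Lemma med_uniq x y z m : I x y m -> I y z m -> I x z m -> m = med x y z.
Proof.
move=> H1 H2 /itvC H3; have [_ /(_ x y z) [m' [_ U]]] := ms.
by rewrite -(U m)// -(U (med x y z))//; have [] := medP x y z.
Qed.

(** Combining the three interval equations gives the Gromov product of [y] and [z] at [x]. *)
Lemma med_dist x y z : 2 * d x (med x y z) = d x y + d x z - d y z.
Proof.
have [] := medP x y z; rewrite /Defs.interval /=.
rewrite (dC z x) (dC z (med x y z)) (dC y (med x y z)) (dC _ x) (dC y z).
by rewrite (dC z y); lra.
Qed.

Lemma med_dist2 x y z : 2 * d y (med x y z) = d x y + d y z - d x z.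
Proof.
have := med_dist x y z; have := medI1 x y z; rewrite /Defs.interval /=.
rewrite (dC y (med x y z)); lra.
Qed.

Lemma med_dist3 x y z : 2 * d z (med x y z) = d x z + d y z - d x y.
Proof.
have := med_dist x y z; have := medI3 x y z; rewrite /Defs.interval /=.
rewrite (dC z (med x y z)); lra.
Qed.

Lemma convex_med12 C x y z : convex C -> C x -> C y -> C (med x y z).
Proof. by move=> cC Cx Cy; apply: (cC x y) => //; exact: medI1. Qed.

Lemma convex_med13 C x y z : convex C -> C x -> C z -> C (med x y z).
Proof. by move=> cC Cx Cz; apply: (cC x z) => //; exact: medI3. Qed.

Lemma convex_med23 C x y z : convex C -> C y -> C z -> C (med x y z).
Proof. by move=> cC Cx Cz; apply: (cC y z) => //; exact: medI2. Qed.

Lemma convexI C K : convex C -> convex K -> convex (C `&` K).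
Proof.
by move=> cC cK x y [Cx Kx] [Cy Ky] z xyz; split; [apply: (cC x y)|apply: (cK x y)].
Qed.

Lemma convexT : convex setT.
Proof. by []. Qed.

Lemma halfspaceC h : halfspace h -> halfspace (~` h).
Proof. by case=> *; split; rewrite ?setCK. Qed.

Lemma hs_convex h : halfspace h -> convex h.
Proof. by case. Qed.

Lemma hs_convexC h : halfspace h -> convex (~` h).
Proof. by case. Qed.

(** Majority rule: were [y] or [z] also outside [h], convexity of the complement would put the
    median there. *)
Lemma med_hs h x y z : halfspace h -> h (med x y z) -> ~ h x -> h y /\ h z.
Proof.
move=> hh hm hx; split; apply: contrapT => H.
  exact: (convex_med12 _ (hs_convexC hh) hx H hm).
exact: (convex_med13 _ (hs_convexC hh) hx H hm).
Qed.

(** * Transversality *)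

Lemma transverseC (h k : set X) : transverse h k -> transverse k h.
Proof. by case=> *; split; rewrite setIC. Qed.

Lemma transverseCl (h k : set X) : transverse h k -> transverse (~` h) k.
Proof. by case=> *; split; rewrite ?setCK. Qed.

Lemma transverseCr (h k : set X) : transverse h k -> transverse h (~` k).
Proof. by case=> *; split; rewrite ?setCK. Qed.

Lemma not_transverse (h k : set X) : ~ transverse h k ->
  [\/ h `&` k = set0, h `&` ~` k = set0, ~` h `&` k = set0 | ~` h `&` ~` k = set0].
Proof.
move=> H; apply: contrapT => H'; apply: H; split; apply: contrapT => /nonemptyPn E;
  by apply: H'; rewrite E; do ?[by constructor 1|by constructor 2|by constructor 3|by constructor 4].
Qed.

Lemma transverse_between (u x y A : set X) : transverse u x -> transverse u y ->
  x `<=` A -> y `<=` ~` A -> transverse u A.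
Proof.
move=> [[p [? ?]] _ [q [? ?]] _] [[r [? ?]] _ [s [? ?]] _] xA yA; split.
- by exists p; split => //; exact: xA.
- by exists r; split => //; exact: yA.
- by exists q; split => //; exact: xA.
- by exists s; split => //; exact: yA.
Qed.

(** * Closures and gates *)

Lemma sub_cl C : C `<=` cl C.
Proof. by move=> x Cx e e0; exists x; rewrite dxx. Qed.

Lemma clS C K : C `<=` K -> cl C `<=` cl K.
Proof. by move=> CK x H e e0; have [y [/CK Ky xy]] := H e e0; exists y. Qed.

Lemma cl_cl C : cl (cl C) `<=` cl C.
Proof.
move=> x H e e0; have e2 : 0 < e / 2 by lra.
have [y [yC xy]] := H _ e2; have [z [zC yz]] := yC _ e2.
by exists z; split => //; have := dT y x z; lra.
Qed.

Lemma clI C K : cl C `<=` C -> cl K `<=` K -> cl (C `&` K) `<=` C `&` K.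
Proof.
move=> HC HK x H; split.
  by apply: HC => e /H [y [[? ?] ?]]; exists y.
by apply: HK => e /H [y [[? ?] ?]]; exists y.
Qed.

Lemma cl_itv x y : cl (I x y) `<=` I x y.
Proof.
move=> z H; rewrite /Defs.interval /=; apply/eqP; rewrite eq_le dT andbT.
apply/ler_addgt0Pr => e e0; have e2 : 0 < e / 2 by lra.
have [w [+ zw]] := H _ e2; rewrite /Defs.interval /= => Hw.
have := dT w x z; have := dT w z y; rewrite (dC w z); lra.
Qed.

Lemma cl_convex C : convex C -> convex (cl C).
Proof.
move=> cC x y xC yC z xyz e e0; have e2 : 0 < e / 2 by lra.
have [x' [Cx' xx']] := xC _ e2; have [y' [Cy' yy']] := yC _ e2.
(* The median is at half the triangle defect of [z], [x'], [y'] from [z]; moving the endpoints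
   raises this defect from 0 to less than [2 * e]. *)
exists (med z x' y'); split; first exact: convex_med23.
have := med_dist z x' y'; move: xyz; rewrite /Defs.interval /=.
have := dT x z x'; have := dT y z y'.
have := dT x' x y; have := dT y' x' y; rewrite (dC y' y) (dC z x); lra.
Qed.

Lemma not_cl C x : ~ cl C x -> exists2 e, 0 < e & forall y, d x y < e -> ~ C y.
Proof.
move=> /existsNP [e /not_implyP [e0 H]]; exists e => // y xy Cy.
by apply: H; exists y.
Qed.

Lemma not_cl_interior C x : ~ cl C x -> interior_X d (~` C) x.
Proof. by move=> /not_cl [e e0 H]; exists e. Qed.

Lemma interior_not_cl C x : interior_X d (~` C) x -> ~ cl C x.
Proof. by move=> [e [e0 H]] /(_ e e0) [y [Cy /H]]. Qed.

Lemma robust_thick h u v : halfspace h -> ~ cl h u -> ~ cl (~` h) v -> thick d h.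
Proof.
move=> hh hu hv; split => //.
  by exists v; have := not_cl_interior hv; rewrite setCK.
by exists u; exact: not_cl_interior.
Qed.

Lemma thickC h : thick d h -> thick d (~` h).
Proof. by case=> hh ? ?; split; rewrite ?setCK//; exact: halfspaceC. Qed.

Lemma thick_hs h : thick d h -> halfspace h.
Proof. by case. Qed.

(** Such a [p] is the unique point of [C] nearest to [x]. *)
Definition gate C x p := C p /\ forall c, C c -> I x c p.

(** A point of [C] outside [h] would have the gate between it and [x], inside the convex complement
    of [h]. *)
Lemma gate_hs C x p h : gate C x p -> halfspace h -> ~ h x -> h p -> C `<=` h.
Proof.
move=> [Cp Hp] hh hx hp c Cc; apply: contrapT => hc.
exact: (hs_convexC hh hx hc (Hp _ Cc)).
Qed.

Lemma gateS C K x p q : K `<=` C -> gate C x p -> gate K x q -> I x q p.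
Proof. by move=> KC [_ Hp] [Kq _]; apply: Hp; apply: KC. Qed.

(** * Completeness *)
Section Complete.
Hypothesis cpl : complete_space d.

Lemma cauchy_lim (u : nat -> X) :
  (forall m n, d (u m) (u n) <= invS m + invS n) ->
  exists l, forall n, d (u n) l <= invS n.
Proof.
move=> H; have [|l Hl] := cpl (u := u).
  move=> e e0; have [|N HN] := @invS_lt R (e / 2); first lra.
  exists N => m n /HN ? /HN ?; have := H m n; lra.
exists l => n; apply/ler_addgt0Pr => e e0; have e2 : 0 < e / 2 by lra.
have [N HN] := Hl _ e2; have [M HM] := invS_lt e2.
have := HN _ (leq_maxl N M); have := HM _ (leq_maxr N M).
have := dT (u (maxn N M)) (u n) l; have := H n (maxn N M); lra.
Qed.

(** A minimizing sequence is Cauchy: the median of [x] and two of its terms lies in [C], so it is no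
    closer to [x] than the infimum, which bounds the distance of the two terms. *)
Lemma gate_exists C x : convex C -> cl C `<=` C -> C !=set0 ->
  exists p, gate C x p.
Proof.
move=> cC clC [c0 Cc0].
pose E := [set d x c | c in C].
have E0 : E !=set0 by exists (d x c0), c0.
have Elb : has_lbound E by exists 0 => _ [c _ <-]; exact: d_ge0.
have Einf c : C c -> inf E <= d x c by move=> Cc; apply: ge_inf => //; exists c.
have /choice [u Hu] : forall n : nat, exists c, C c /\ d x c < inf E + invS n.
  move=> n; have n0 := @invS_gt0 R n.
  by have [_ [c Cc <-] Hc] := inf_adherent n0 (conj E0 Elb); exists c.
have [m n|l Hl] := @cauchy_lim u.
  have [Cm um] := Hu m; have [Cn un] := Hu n.
  have := Einf _ (convex_med23 x cC Cm Cn).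
  have := med_dist x (u m) (u n); lra.
have clCl : C l.
  apply: clC => e e0; have [N /(_ N (leqnn _)) HN] := invS_lt e0.
  exists (u N); split; first by have [] := Hu N.
  by rewrite dC; have := Hl N; lra.
have dl : d x l <= inf E.
  apply/ler_addgt0Pr => e e0; have [|N /(_ N (leqnn _)) HN] := @invS_lt R (e / 2).
    lra.
  have [_ ] := Hu N; have := Hl N; have := dT (u N) x l; lra.
exists l; split => // c Cc.
(* This median lies in [C] between [x] and [l], and [l] is at minimal distance. *)
suff <- : med x l c = l by exact: medI3.
apply: d_eq0; have := Einf _ (convex_med23 x cC clCl Cc).
have := medI1 x l c; rewrite /Defs.interval /=; have := d_ge0 (med x l c) l; lra.
Qed.

(** A bounded monotone net converges; [op j (k n)] runs over the indices beyond [k n]. *)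
Lemma monotone_net (J : Type) (j0 : J) (op : J -> J -> J) (c : J -> X) a B :
  (forall i j, I a (c (op i j)) (c i) /\ I a (c (op i j)) (c j)) ->
  (forall j, d a (c j) <= B) ->
  exists (k : nat -> J) l, forall n j, d (c (op j (k n))) l <= 2 * invS n.
Proof.
move=> mono bnd; pose E := range (fun j => d a (c j)).
have E0 : E !=set0 by exists (d a (c j0)), j0.
have Eub : has_ubound E by exists B => _ [j _ <-]; exact: bnd.
have Esup j : d a (c j) <= sup E by apply: ub_le_sup => //; exists j.
have /choice [k Hk] : forall n : nat, exists j, sup E - invS n < d a (c j).
  move=> n; have n0 := @invS_gt0 R n.
  by have [_ [j _ <-] Hj] := sup_adherent n0 (conj E0 Eub); exists j.
have near i n : d (c (op i (k n))) (c (k n)) <= invS n.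
  have [_] := mono i (k n); rewrite /Defs.interval /=.
  have := Esup (op i (k n)); have := Hk n; rewrite (dC (c (op _ _))); lra.
have near' i n : d (c (op (k n) i)) (c (k n)) <= invS n.
  have [+ _] := mono (k n) i; rewrite /Defs.interval /=.
  have := Esup (op (k n) i); have := Hk n; rewrite (dC (c (op _ _))); lra.
have [m n|l Hl] := @cauchy_lim (c \o k).
  have := near (k m) n; have := near' (k n) m => /=.
  have := dT (c (op (k m) (k n))) (c (k m)) (c (k n)).
  by rewrite (dC (c (k m)) (c (op _ _))); lra.
exists k, l => n i.
have := near i n; have := Hl n; have /= := dT (c (k n)) (c (op i (k n))) l; lra.
Qed.

End Complete.

(** * Finite intersections *)
Section FiniteIntersections.
Context {J : Type} (F : J -> set X).

Fixpoint fint (l : seq J) : set X :=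
  if l is i :: l' then F i `&` fint l' else setT.

Lemma fint_cat l1 l2 : fint (l1 ++ l2) = fint l1 `&` fint l2.
Proof. by elim: l1 => [|i l1 IH] /=; rewrite ?setTI// IH setIA. Qed.

Hypothesis Fcvx : forall i, convex (F i).

Lemma fint_convex l : convex (fint l).
Proof. by elim: l => [|i l IH] /=; [exact: convexT|exact: convexI]. Qed.

Lemma fint_closed : (forall i, cl (F i) `<=` F i) ->
  forall l, cl (fint l) `<=` fint l.
Proof. by move=> H; elim=> [|i l IH] //=; exact: clI. Qed.

Lemma helly3 C1 C2 C3 : convex C1 -> convex C2 -> convex C3 ->
  C1 `&` C2 !=set0 -> C2 `&` C3 !=set0 -> C1 `&` C3 !=set0 ->
  (C1 `&` C2) `&` C3 !=set0.
Proof.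
move=> c1 c2 c3 [x [? ?]] [y [? ?]] [z [? ?]]; exists (med x y z).
split; [split|]; [exact: convex_med13|exact: convex_med12|exact: convex_med23].
Qed.

(** Induction absorbs one [F i] at a time into [C]; [helly3] keeps the pairwise intersections
    nonempty. *)
Lemma helly (l : seq J) C :
  (forall i j, F i `&` F j !=set0) -> convex C -> C !=set0 ->
  (forall i, C `&` F i !=set0) -> C `&` fint l !=set0.
Proof.
move=> FF; elim: l C => [|i l IH] C cC C0 CF /=; first by rewrite setIT.
rewrite setIA; apply: IH => //; first exact: convexI.
by move=> j; exact: helly3.
Qed.

Lemma fint_neq0 l : X -> (forall i j, F i `&` F j !=set0) -> fint l !=set0.
Proof.
move=> x FF; have [|i|y [_ ?]] := @helly l setT FF convexT.
- by exists x.
- by rewrite setTI; have [y [? _]] := FF i i; exists y.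
- by exists y.
Qed.

End FiniteIntersections.

(** The gates of [x] in the finite intersections form a bounded monotone net. Its limit is in every
    [F i], since [F i] is closed and contains all gates whose index includes [i]. *)
Lemma compact_family (cpl : complete_space d) (J : Type) (F : J -> set X) x B :
  (forall i, convex (F i)) -> (forall i, cl (F i) `<=` F i) ->
  (forall i j, F i `&` F j !=set0) ->
  (exists i, forall y, F i y -> d x y <= B) ->
  exists y, forall i, F i y.
Proof.
move=> Fc Fcl FF [i0 Fb].
pose K l := F i0 `&` fint F l.
have Kc l : convex (K l) by apply: (@fint_convex _ _ Fc (i0 :: l)).
have Kcl l : cl (K l) `<=` K l by apply: (@fint_closed _ _ Fcl (i0 :: l)).
have K0 l : K l !=set0 by apply: (@fint_neq0 _ _ Fc (i0 :: l)).
have /choice [p Hp] : forall l, exists p, gate (K l) x p.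
  by move=> l; apply: gate_exists.
have [i j|j|k [y Hy]] := @monotone_net cpl _ [::] (fun l1 l2 => l1 ++ l2) p x B.
- split; apply: (gateS _ (Hp _) (Hp _)); rewrite /K fint_cat => z [? []] //.
- by apply: Fb; have [[]] := Hp j.
exists y => i; apply: Fcl => e e0.
have [|N /(_ N (leqnn _)) HN] := @invS_lt R (e / 2); first lra.
exists (p ([:: i] ++ k N)); split; last by rewrite dC; have := Hy N [:: i]; lra.
by have [[_ []]] := Hp ([:: i] ++ k N).
Qed.


(** * Consequences of separation by halfspaces *)
Section Separation.
Hypothesis sep : forall x y, x <> y -> exists h, [/\ halfspace h, ~ h x & h y].

Lemma hs_eq x y : (forall h, halfspace h -> h x -> h y) -> x = y.
Proof. by move=> H; apply: contrapT => /nesym /sep [h [hh hy /(H _ hh)]]. Qed.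

Lemma itv_convex x y : convex (I x y).
Proof.
move=> u v Iu Iv w Iw.
(* The projection of [w] to [I x y] is compared with [w] halfspace by halfspace. *)
suff -> : w = med x y w by exact: medI1.
apply: hs_eq => h hh hw; have hc := hs_convex hh; have hcC := hs_convexC hh.
have [hx|hx] := pselect (h x); first exact: convex_med13.
have [hy|hy] := pselect (h y); first exact: convex_med23.
by case: (hcC _ _ (hcC _ _ hx hy _ Iu) (hcC _ _ hx hy _ Iv) _ Iw hw).
Qed.

Lemma hsiP x y h : hsi d x y h <-> [/\ halfspace h, ~ h x & h y].
Proof.
split; first by case=> -[hh hy] H; split => // hx; apply: H.
by case=> hh hx hy; split => // -[].
Qed.

Lemma hsiC x y h : hsi d x y h -> hsi d y x (~` h).
Proof. by move=> /hsiP[hh hx hy]; apply/hsiP; split=> //; exact: halfspaceC. Qed.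

Lemma hsi_itvl u v p q h : I u v q -> I u q p -> hsi d p q h -> hsi d u v h.
Proof.
move=> uvq uqp /hsiP[hh hp hq]; apply/hsiP; split => //.
  by move=> hu; apply: hp; apply: (hs_convex hh hu hq).
apply: contrapT => hv; have [_ pvq] := itv_trans uvq uqp.
exact: (hs_convexC hh hp hv pvq).
Qed.

(** * Finite rank and halfspaces adherent to an endpoint of an interval *)

Section FiniteRank.
Variable n : nat.
Hypothesis rk : forall (k : nat) (f : nat -> set X),
  (forall i, (i < k)%N -> halfspace (f i)) ->
  (forall i j, (i < k)%N -> (j < k)%N -> i <> j -> transverse (f i) (f j)) ->
  (k <= n)%N.

Lemma near_common u v m (h : nat -> set X) :
  (forall i, (i < m)%N -> hsi d u v (h i)) ->
  (forall i, (i < m)%N -> cl (h i) u) -> forall e, 0 < e ->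
  exists q, [/\ I u v q, forall i, (i < m)%N -> h i q & d u q < e].
Proof.
elim: m => [|m IH] Hh Hcl e e0.
  by exists u; rewrite dxx; split => //; exact: itvl.
(* The witness joins [q] to the projection of a nearby [y]; its distance to [u] is at most
   [2 * d u q + d u y]. *)
have e3 : 0 < e / 3 by lra.
have [|||q [uvq hq uq]] := IH _ _ (e / 3) => //.
- by move=> i im; apply: Hh; exact: ltnW.
- by move=> i im; apply: Hcl; exact: ltnW.
have [y [hy uy]] := Hcl _ (ltnSn m) _ e3.
have [_ _ hvm] := (hsiP _ _ _).1 (Hh _ (ltnSn m)).
have hcm : convex (h m) by have /hsiP[/hs_convex] := Hh _ (ltnSn m).
exists (med v q (med u v y)); split.
- apply: (itv_convex (itvr _ _) uvq); exact: medI1.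
- move=> i; rewrite ltnS leq_eqVlt => /orP[/eqP->|im].
    by apply: convex_med13 => //; exact: convex_med23.
  have /hsiP[/hs_convex hci _ hvi] := Hh _ (leqW im).
  by apply: convex_med12 => //; exact: hq.
have := medI2 v q (med u v y); have := medI3 u v y; rewrite /Defs.interval /=.
have := dT q u (med v q (med u v y)); have := dT u q (med u v y).
have := d_ge0 (med v q (med u v y)) (med u v y).
have := d_ge0 (med u v y) y; rewrite (dC q u); lra.
Qed.

(** In the interval with bottom [u] and top [v], [med v x y] is the join; likewise [med u x y] is
    the meet. *)
Lemma join_props u v x y : I u v x -> I u v y ->
  [/\ I u v (med v x y), I u (med v x y) x & I u (med v x y) y].
Proof.
move=> ux uy; have H1 := medI1 v x y; have H2 := medI3 v x y.
split; first by apply: (itv_convex (itvr _ _) ux).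
  by have [] := itv_trans (itvC ux) H1; move=> _ /itvC.
by have [] := itv_trans (itvC uy) H2; move=> _ /itvC.
Qed.

(* The [h i] need not be transverse; the [j i] of the proof, obtained by perturbing
   them near [u], are. *)
Lemma rank_chain u v m (h : nat -> set X) (w : nat -> X) :
  (forall i, (i < m)%N -> hsi d u v (h i)) ->
  (forall i, (i < m)%N -> cl (h i) u) ->
  (forall i, (i < m)%N -> h i (w i)) ->
  (forall i k, (i < k)%N -> (k < m)%N -> ~ h k (w i)) -> (m <= n)%N.
Proof.
move=> Hh Hcl Hw Hnw.
(* [V] climbs from [u] by joining the projections of the [w i]; each [h i] separates [V i] from
   [V i.+1]. *)
pose V := fix V i := if i is i'.+1 then med v (V i') (med u v (w i')) else u.
have Vuv i : I u v (V i).
  elim: i => [|i IH] /=; first exact: itvl.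
  by have [] := join_props IH (medI1 u v (w i)).
have VS i : I u (V i.+1) (V i).
  by have [_ ? _] := join_props (Vuv i) (medI1 u v (w i)).
have Vmono i k : (i <= k)%N -> I u (V k) (V i).
  elim: k => [|k IH]; first by rewrite leqn0 => /eqP->; exact: itvr.
  rewrite leq_eqVlt => /orP[/eqP->|]; first exact: itvr.
  by rewrite ltnS => /IH H; have [] := itv_trans (VS k) H.
have hV i : (i < m)%N -> h i (V i.+1).
  move=> im; have /hsiP[/hs_convex hc _ hv] := Hh _ im.
  by apply: convex_med13 => //; apply: convex_med23 => //; exact: Hw.
have hV' k i : (k < m)%N -> (i <= k)%N -> ~ h k (V i).
  move=> km; have /hsiP[hh hu hv] := Hh _ km; have hc := hs_convexC hh.
  elim: i => [|i IH] //= ik.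
  apply: (convex_med23 _ hc); first by apply: IH; exact: ltnW.
  by apply: (convex_med13 _ hc) => //; exact: Hnw.
pose good q := I u v q /\ forall i, (i < m)%N -> h i q.
(* Below [q] there is a [q'], still in all [h k], so close to [u] that the join of [V i] and [q']
   does not dominate the meet [p] of [V i.+1] and [q]. *)
have /choice [f Hf] : forall iq : nat * X, exists q', (iq.1 < m)%N -> good iq.2 ->
    let p := med u (V iq.1.+1) iq.2 in
    [/\ good q', I u iq.2 q' & med u p (med v (V iq.1) q') <> p].
  move=> [i q] /=; have [im|] := boolP (i < m)%N; last by exists u.
  have [[uvq hq]|] := pselect (good q); last by exists u.
  set p := med u (V i.+1) q.
  have hhi : halfspace (h i) by have /hsiP[] := Hh _ im.
  have hp : h i p by apply: (convex_med23 _ (hs_convex hhi)); [exact: hV|exact: hq].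
  have hpm : ~ h i (med u p (V i)).
    apply: (convex_med13 _ (hs_convexC hhi)); last exact: hV'.
    by have /hsiP[] := Hh _ im.
  have pp : 0 < d p (med u p (V i)) by apply: d_gt0 => E; apply: hpm; rewrite -E.
  have [q1 [uvq1 hq1 uq1]] := near_common Hh Hcl pp.
  exists (med u q1 q) => _ _; split.
  - split; first by apply: (itv_convex (itvl _ _) uvq1); exact: medI1.
    move=> k km; have /hsiP[/hs_convex hc _ _] := Hh _ km.
    by apply: (convex_med23 _ hc); [exact: hq1|exact: hq].
  - exact: medI3.
  set q' := med u q1 q; set e := med v _ _ => E.
  have uq' : d u q' <= d u q1.
    by have := medI1 u q1 q; have := d_ge0 q' q1; rewrite /Defs.interval /=; rewrite -/q'; lra.
  have := med_dist2 u p e; have := med_dist2 u p (V i).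
  rewrite E dxx; have := med_dist2 v (V i) q'; rewrite -/e.
  have := Vuv i; rewrite /Defs.interval /=.
  have := dT u (V i) q'; have := dT q' u v; have := dT (V i) u e.
  have := dT e p (V i); have := d_ge0 u e.
  rewrite (dC (V i) u) (dC v (V i)) (dC e (V i)) (dC v q') (dC u v); lra.
(* [Q] descends from [v] while [V] climbs; [j i] will contain [V i.+1] and [Q i] but neither [V i]
   nor [Q i.+1]. *)
pose Q := fix Q i := if i is i'.+1 then f (i', Q i') else v.
have Qgood i : (i <= m)%N -> good (Q i).
  elim: i => [_|i IH im] /=.
    by split; [exact: itvr|move=> k km; have /hsiP[] := Hh _ km].
  by have [] := Hf (i, Q i) im (IH (ltnW im)).
have QS i : (i < m)%N -> I u (Q i) (Q i.+1).
  by move=> im; have [] := Hf (i, Q i) im (Qgood _ (ltnW im)).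
have Qmono i k : (i <= k)%N -> (k <= m)%N -> I u (Q i) (Q k).
  move=> + km; elim: k km => [|k IH] km; first by rewrite leqn0 => /eqP->; exact: itvr.
  rewrite leq_eqVlt => /orP[/eqP->|]; first exact: itvr.
  rewrite ltnS => /(IH (ltnW km)) H.
  by have [] := itv_trans H (QS _ km).
have /choice [j Hj] : forall i, exists j, (i < m)%N ->
    [/\ halfspace j, ~ j u, j v & [/\ j (V i.+1), j (Q i), ~ j (V i) & ~ j (Q i.+1)]].
  move=> i; have [im|] := boolP (i < m)%N; last by exists set0.
  have [_ _] := Hf (i, Q i) im (Qgood _ (ltnW im)); rewrite -/(Q i.+1) /=.
  set p := med u (V i.+1) (Q i); set e := med v (V i) _ => Hpe.
  have [j [hj jpe jp]] := sep Hpe; exists j => _.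
  have ju : ~ j u by move=> H; apply: jpe; exact: (convex_med12 _ (hs_convex hj)).
  have je : ~ j e by move=> H; apply: jpe; exact: (convex_med23 _ (hs_convex hj)).
  have [uvQ _] := Qgood i (ltnW im); have [uvQ' _] := Qgood _ im.
  have [uve ueV ueQ] := join_props (Vuv i) uvQ'.
  have jV : j (V i.+1).
    apply: contrapT => H; suff: ~ j p by apply.
    exact: (convex_med12 _ (hs_convexC hj)).
  split => //.
    apply: contrapT => jv; suff: ~ j p by apply.
    apply: (hs_convexC hj ju jv); apply: (itv_convex (itvl _ _) uvQ).
    exact: medI3.
  split => //.
  - apply: contrapT => H; suff: ~ j p by apply.
    exact: (convex_med13 _ (hs_convexC hj)).
  - exact: (hs_convexC hj ju je).
  - exact: (hs_convexC hj ju je).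
(* The four corners are witnessed by [v], [V i.+1], [Q k] and [u]. *)
have tr i k : (i < k)%N -> (k < m)%N -> transverse (j i) (j k).
  move=> ik km; have [hi iu iv [iV iQ iV' iQ']] := Hj _ (ltn_trans ik km).
  have [hk ku kv [kV kQ kV' kQ']] := Hj _ km; split.
  - by exists v.
  - exists (V i.+1); split => //.
    exact: (hs_convexC hk ku kV' (Vmono _ _ ik)).
  - exists (Q k); split => //.
    exact: (hs_convexC hi iu iQ' (Qmono _ _ ik (ltnW km))).
  - by exists u.
apply: (rk (f := j)) => [i im|i k im km ik]; first by have [] := Hj _ im.
case: (ltngtP i k) ik => [ik _|ki _|->//]; first exact: tr.
by apply: transverseC; exact: tr.
Qed.

Lemma rank_chain_rev u v m (h : nat -> set X) (w : nat -> X) :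
  (forall i, (i < m)%N -> hsi d u v (h i)) ->
  (forall i, (i < m)%N -> cl (h i) u) ->
  (forall i, (i < m)%N -> h i (w i)) ->
  (forall i k, (k < i)%N -> (i < m)%N -> ~ h k (w i)) -> (m <= n)%N.
Proof.
move=> Hh Hcl Hw Hnw.
have lt i : (i < m)%N -> (m.-1 - i < m)%N.
  by case: m {Hh Hcl Hw Hnw} => // m _; rewrite ltnS leq_subr.
apply: (@rank_chain u v m (fun i => h (m.-1 - i)%N) (fun i => w (m.-1 - i)%N)).
- by move=> i /lt; exact: Hh.
- by move=> i /lt; exact: Hcl.
- by move=> i /lt; exact: Hw.
move=> i k ik km; apply: Hnw; last by apply: lt; exact: ltn_trans km.
by case: m km {Hh Hcl Hw lt} => // m km /=; rewrite ltn_sub2l// (leq_trans ik).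
Qed.

(** Otherwise every halfspace separating [u] from [v] is adherent to [u], or its complement to [v].
    Adherence of [h] gives points descending strictly from [v] towards [u], hence a long chain of
    separating halfspaces; [rank_chain] bounds each of the two kinds by [n]. *)
Lemma robust_left u v h : hsi d u v h -> cl h u ->
  exists l, [/\ halfspace l, ~ cl l u & ~ cl (~` l) v].
Proof.
move=> /hsiP[hh hu hv] clu; apply: contrapT => nol.
have Hl l : hsi d u v l -> ~ cl l u -> cl (~` l) v.
  move=> /hsiP[hl _ _] lu; apply: contrapT => lv; apply: nol; by exists l.
have /choice [f Hf] : forall q, exists q', I u v q -> h q ->
    [/\ I u v q', I u q q', h q' & q' <> q].
  move=> q; have [[uvq hq]|] := pselect (I u v q /\ h q); last first.
    by move=> H; exists u => ? ?; case: H.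
  have uq : 0 < d u q by apply: d_gt0 => E; apply: hu; rewrite E.
  have [y [hy uy]] := clu _ uq; exists (med u q y) => _ _; split.
  - by apply: (itv_convex (itvl _ _) uvq); exact: medI1.
  - exact: medI1.
  - exact: (convex_med23 _ (hs_convex hh)).
  move=> E; have := medI3 u q y; rewrite E /Defs.interval /=.
  have := d_ge0 q y; lra.
pose U := fix U i := if i is i'.+1 then f (U i') else v.
have Ug i : I u v (U i) /\ h (U i).
  elim: i => [|i [IH1 IH2]] /=; first by split=> //; exact: itvr.
  by have [] := Hf _ IH1 IH2.
have US i : I u (U i) (U i.+1).
  by have [H1 H2] := Ug i; have [] := Hf _ H1 H2.
have Umono i k : (i <= k)%N -> I u (U i) (U k).
  elim: k => [|k IH]; first by rewrite leqn0 => /eqP->; exact: itvr.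
  rewrite leq_eqVlt => /orP[/eqP->|]; first exact: itvr.
  by rewrite ltnS => /IH H; have [] := itv_trans H (US k).
have /choice [L HL] : forall i, exists l, hsi d (U i.+1) (U i) l.
  move=> i; have [H1 H2] := Ug i; have [_ _ _ /sep [l ?]] := Hf _ H1 H2.
  by exists l; apply/hsiP.
have Luv i : hsi d u v (L i).
  by apply: hsi_itvl (HL i); [have [] := Ug i|exact: US].
have LU i k : (i < k)%N -> ~ L i (U k).
  move=> ik; have /hsiP[hl lu _] := Luv i; have /hsiP[_ lU _] := HL i.
  exact: (hs_convexC hl lu lU (Umono _ _ ik)).
have LU' i k : (k <= i)%N -> L i (U k).
  move=> ki; apply: contrapT => H; have /hsiP[hl lu _] := Luv i.
  have /hsiP[_ _ ] := HL i.
  exact: (hs_convexC hl lu H (Umono _ _ ki)).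
pose c i := `[< cl (L i) u >].
(* More than [n + n] halfspaces, so one of the two kinds occurs more than [n] times. *)
pose N := (n.+1 + n.+1)%N.
pose A := [seq i <- iota 0 N | c i]; pose B := [seq i <- iota 0 N | ~~ c i].
have szAB : (size A + size B)%N = N.
  by rewrite !size_filter count_predC size_iota.
have sA : sorted ltn A by apply: sorted_filter; [exact: ltn_trans|exact: iota_ltn_sorted].
have sB : sorted ltn B by apply: sorted_filter; [exact: ltn_trans|exact: iota_ltn_sorted].
have nthlt (s : seq nat) i k : sorted ltn s -> (i < k)%N -> (k < size s)%N ->
    (nth 0 s i < nth 0 s k)%N.
  move=> ss ik ks; apply: (sorted_ltn_nth ltn_trans) => //; rewrite inE//.
  exact: ltn_trans ks.
have lA : (size A <= n)%N.
  apply: (@rank_chain_rev u v _ (fun i => L (nth 0 A i)) (fun i => U (nth 0 A i))).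
  - by move=> i _; exact: Luv.
  - by move=> i /(mem_nth 0%N); rewrite mem_filter => /andP[/asboolP].
  - by move=> i _; exact: LU'.
  - by move=> i k ki im; apply: LU; exact: nthlt.
have lB : (size B <= n)%N.
  apply: (@rank_chain v u _ (fun i => ~` L (nth 0 B i)) (fun i => U (nth 0 B i).+1)).
  - by move=> i _; apply: hsiC; exact: Luv.
  - move=> i /(mem_nth 0%N); rewrite mem_filter => /andP[/asboolPn H _].
    by apply: Hl => //; exact: Luv.
  - by move=> i _; exact: LU.
  - by move=> i k ik km; apply; apply: LU'; exact: nthlt.
by have := leq_add lA lB; rewrite szAB /N addSn addnS ltnNge leqnSn.
Qed.

(** This is the source of thick halfspaces. A separating halfspace failing at [u] is replaced
    through [robust_left], one failing at [v] through its complement. *)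
Lemma robust_sep u v : u <> v ->
  exists h, [/\ halfspace h, ~ cl h u & ~ cl (~` h) v].
Proof.
move=> /sep [h [hh hu hv]]; have H : hsi d u v h by apply/hsiP.
have [clu|clu] := pselect (cl h u); first exact: robust_left H clu.
have [clv|clv] := pselect (cl (~` h) v); last by exists h.
have [l [hl lv lu]] := robust_left (hsiC H) clv.
by exists (~` l); rewrite setCK; split => //; exact: halfspaceC.
Qed.

Section CompleteFiniteRank.
Hypothesis cpl : complete_space d.

(* Were [n |-> op L (k n)] never cofinal, iterating would give infinitely many
   halfspaces adherent to the limit of the net. *)
Lemma countable_cofinal (J : Type) (j0 : J) (op : J -> J -> J) (c : J -> X) a b :
  (forall i j, I a (c (op i j)) (c i) /\ I a (c (op i j)) (c j)) ->
  (forall j, I a b (c j)) ->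
  exists k : nat -> J, forall h j, halfspace h -> ~ h a -> h (c j) ->
    exists i, h (c (k i)).
Proof.
move=> mono cb.
have [j|k [l Hl]] := @monotone_net cpl _ j0 op c a (d a b) mono.
  by have := cb j; rewrite /Defs.interval /=; have := d_ge0 (c j) b; lra.
(* The limit is an upper bound of the net, as seen from [a]. *)
have cal j : I a l (c j).
  apply: cl_itv => e e0.
  have [|N /(_ N (leqnn _)) HN] := @invS_lt R (e / 2); first lra.
  exists (med a l (c j)); split; first exact: medI1.
  have := med_dist3 a l (c j); have := Hl N j.
  have [+ _] := mono j (k N); rewrite /Defs.interval /=.
  have := dT (c (op j (k N))) a l; have := dT (c (op j (k N))) (c j) l.
  have := dT l a (c (op j (k N))); rewrite (dC l (c (op _ _))) (dC l (c j)).
  by lra.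
apply: contrapT => noex.
have /choice [H /choice [L' HL]] : forall L, exists h, exists L', [/\ halfspace h, ~ h a, h (c L') &
    forall i, ~ h (c (op L (k i)))].
  move=> L; apply: contrapT => no; apply: noex; exists (fun i => op L (k i)).
  move=> h j hh ha hj; apply: contrapT => no'; apply: no; exists h, j; split => //.
  by move=> i hi; apply: no'; exists i.
pose L := fix L i := if i is i'.+1 then op (L i') (L' (L i')) else j0.
have LS i : I a (c (L i.+1)) (c (L i)) by have [] := mono (L i) (L' (L i)).
have Lmono i j : (i <= j)%N -> I a (c (L j)) (c (L i)).
  elim: j => [|j IH]; first by rewrite leqn0 => /eqP->; exact: itvr.
  rewrite leq_eqVlt => /orP[/eqP->|]; first exact: itvr.
  by rewrite ltnS => /IH Hij; have [] := itv_trans (LS j) Hij.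
have HLS i j : (i < j)%N -> H (L i) (c (L j)).
  move=> ij; have [hh ha hL' _] := HL (L i).
  apply: contrapT => no; have /= [_ H2] := mono (L i) (L' (L i)).
  have [H3 _] := itv_trans (Lmono _ _ ij) H2.
  exact: (hs_convexC hh ha no H3).
(* The complements of the [H (L i)] contain [a] and miss [l], but are adherent to [l], because the
   net beyond [L i] avoids [H (L i)] along [k]. *)
have := @rank_chain_rev l a n.+1 (fun i => ~` H (L i)) (fun i => c (L i)).
rewrite ltnn => F; apply: notF; apply: F => i.
- move=> _; apply/hsiP; have [hh ha hL' _] := HL (L i).
  split; [exact: halfspaceC| |by []].
  by apply; apply: contrapT => no; exact: (hs_convexC hh ha no (cal (L' (L i)))).
- move=> _ e e0; have [|N /(_ N (leqnn _)) HN] := @invS_lt R (e / 2); first lra.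
  have [_ _ _ no] := HL (L i); exists (c (op (L i) (k N))); split; first exact: no.
  by rewrite dC; have := Hl N (L i); lra.
- move=> _; have [hh ha _ no] := HL (L i).
  by have [H1 _] := mono (L i) (k 0%N); exact: (hs_convexC hh ha (no 0%N) H1).
- by move=> j ji _; apply; exact: HLS.
Qed.

(** * The measure on halfspaces *)

Local Notation hsi := (Defs.hsi d).
Local Notation Bsig := (Defs.Bsig d).
Local Notation HS := (Defs.HS d).
Local Notation sigma_pt := (Defs.sigma_pt d).

Lemma hsi_notin a b x :
  hsi a b `&` [set h | ~ h x] = hsi (med a b x) b.
Proof.
apply/seteqP; split=> h; rewrite /= !hsiP.
  by case=> -[hh ha hb] hx; split=> //; exact: (convex_med13 _ (hs_convexC hh)).
case=> hh hm hb; split; first split => //.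
- by move=> ha; apply: hm; exact: (convex_med12 _ (hs_convex hh)).
- by move=> hx; apply: hm; exact: (convex_med23 _ (hs_convex hh)).
Qed.

Lemma hsi_in a b x : hsi a b `&` [set h | h x] = hsi a (med a b x).
Proof.
apply/seteqP; split=> h; rewrite /= !hsiP.
  by case=> -[hh ha hb] hx; split=> //; exact: (convex_med23 _ (hs_convex hh)).
by case=> hh ha hm; have [hb hx] := med_hs hh hm ha; split.
Qed.

(** Two cuts by majority. It makes the sets [hsi x y] a pi-system generating [Bsig], and recognizes
    two simultaneous separations as one. *)
Lemma hsi_setI a b x y : hsi a b `&` hsi x y =
  hsi (med a b x) (med (med a b x) b y).
Proof.
rewrite -hsi_in -hsi_notin; apply/seteqP; split=> h; rewrite /= !hsiP.
  by case=> -[? ? ?] [].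
by case=> -[[? ? ?] ? ?]; split; split.
Qed.

Lemma Bsig_HS E : Bsig E -> E `<=` HS.
Proof.
move: E; apply: smallest_sub.
  split=> [h []|A _|F HF]; [exact: subDsetl|exact: bigcup_sub].
by move=> _ [x [y ->]] h /hsiP[].
Qed.

Lemma Bsig_props : [/\ Bsig HS, setD_closed Bsig,
  setI_closed Bsig & forall F : nat -> _, (forall i, Bsig (F i)) -> Bsig (\bigcup_i F i)].
Proof.
have SA := smallest_sigma_algebra HS [set E | exists x y, E = hsi x y].
have [sT sD _ sI] := (sigma_algebraP Bsig_HS).1 SA.
have [_ _ sU] := SA; split => //.
(* [sD] subtracts only subsets, so [B] is first cut down to [A]. *)
move=> A B BA BB; rewrite -[_ `\` _]set0U -[X in X `|` _](setDv A) -setDIr.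
by apply: sD => //; exact: sI.
Qed.

Lemma Bsig_I : setI_closed Bsig. Proof. by have [] := Bsig_props. Qed.

Lemma Bsig_D : setD_closed Bsig. Proof. by have [] := Bsig_props. Qed.

Lemma Bsig_bigcup (F : nat -> set (set X)) :
  (forall i, Bsig (F i)) -> Bsig (\bigcup_i F i).
Proof. by have [_ _ _] := Bsig_props; apply. Qed.

Lemma Bsig0 : Bsig set0.
Proof. by have [] := smallest_sigma_algebra HS [set E | exists x y, E = hsi x y]. Qed.

Lemma Bsig_U : setU_closed Bsig.
Proof.
move=> A B BA BB; rewrite -bigcup2E; apply: Bsig_bigcup => -[|[|i]] //=.
exact: Bsig0.
Qed.

Lemma Bsig_hsi x y : Bsig (hsi x y).
Proof. by apply: sub_gen_smallest; exists x, y. Qed.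

(** * Locally measurable sets of halfspaces and ultrafilters *)

Definition hmeas (s : set (set X)) := forall a b, Bsig (s `&` hsi a b).

Lemma hmeasI s t : hmeas s -> hmeas t -> hmeas (s `&` t).
Proof. by move=> Hs Ht a b; rewrite setIIl; exact: Bsig_I. Qed.

Lemma hmeasU s t : hmeas s -> hmeas t -> hmeas (s `|` t).
Proof. by move=> Hs Ht a b; rewrite setIUl; exact: Bsig_U. Qed.

Lemma hmeasD s t : hmeas s -> hmeas t -> hmeas (s `\` t).
Proof.
move=> Hs Ht a b; rewrite (_ : _ `&` _ = (s `&` hsi a b) `\` (t `&` hsi a b)).
  exact: Bsig_D.
by apply/seteqP; split=> h; rewrite /setI /setD /=; tauto.
Qed.

Lemma hmeas_symdiff s t : hmeas s -> hmeas t -> hmeas (symdiff s t).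
Proof. by move=> Hs Ht; apply: hmeasU; exact: hmeasD. Qed.

Lemma hmeas_sigma x : hmeas (sigma_pt x).
Proof.
move=> a b; rewrite (_ : _ `&` _ = hsi a (med a b x)); first exact: Bsig_hsi.
rewrite -hsi_in; apply/seteqP; split=> h /=; first by case=> -[].
by case=> H hx; split=> //; split=> //; have /hsiP[] := H.
Qed.

Lemma hmeas_medianU a b c : hmeas a -> hmeas b -> hmeas c -> hmeas (medianU a b c).
Proof. by move=> *; apply: hmeasU; [apply: hmeasU|]; exact: hmeasI. Qed.

Lemma symdiffK (s t : set (set X)) : symdiff (symdiff s t) t = s.
Proof.
apply/seteqP; split=> h; rewrite /symdiff /setU /setD /=;
  by have [] := pselect (t h); have [] := pselect (s h); tauto.
Qed.

(** Each [sigma_pt x] is itself locally measurable, so the base point in [in_Xbar] drops out. *)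
Lemma in_XbarE s (x : X) : in_Xbar d s <-> ultrafilter d s /\ hmeas s.
Proof.
split=> [[us [y [_ Hy]]]|[us Hs]]; split => //.
  rewrite -(symdiffK s (sigma_pt y)); apply: hmeas_symdiff => //.
  exact: hmeas_sigma.
exists x; split; last by apply: hmeas_symdiff => //; exact: hmeas_sigma.
by move=> h [[] sh _|[[]] //]; have [H _ _] := us; exact: H.
Qed.

Lemma ultrafilterP (s : set (set X)) : ultrafilter d s <->
  [/\ s `<=` HS, forall h k, s h -> s k -> h `&` k !=set0 &
      forall h, halfspace h -> s h \/ s (~` h)].
Proof.
split=> -[sH spw H]; split => //; last first.
  move=> t tH tpw st; apply/seteqP; split=> // h th.
  have [//|shC] := H h (tH _ th); have [x []] := tpw _ _ th (st _ shC).
  by [].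
move=> h hh; have [sh|nsh] := pselect (s h); [by left|right].
(* By maximality something in [s] must be disjoint from [h]; the complement of [h] contains it,
   hence meets all of [s] and can be added. *)
have [k [sk hk]] : exists k, s k /\ h `&` k = set0.
  apply: contrapT => /forallNP no; apply: nsh.
  rewrite -(H (s `|` [set h])); first by right.
  - by move=> k [/sH//|->].
  - have hk k : s k -> h `&` k !=set0.
      by move=> sk; apply: contrapT => /nonemptyPn hk; apply: (no k).
    move=> k l [sk|->] [sl|->]; [exact: spw| |exact: hk|].
      by rewrite setIC; exact: hk.
    by have [[x ?] _ _ _] := hh; exists x.
  - by move=> k; left.
have kh : k `<=` ~` h by move=> x kx hx; suff : set0 x by []; rewrite -hk.
have Hk l : s l -> (~` h) `&` l !=set0.
  by move=> sl; have [x [? ?]] := spw _ _ sk sl; exists x; split=> //; exact: kh.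
rewrite -(H (s `|` [set ~` h])); first by right.
- by move=> l [/sH//|->]; exact: halfspaceC.
- move=> l m [sl|->] [sm|->]; [exact: spw| |exact: Hk|].
    by rewrite setIC; exact: Hk.
  by have [_ [x ?] _ _] := hh; exists x.
- by move=> l; left.
Qed.

Lemma sigma_pt_Xbar x : in_Xbar d (sigma_pt x).
Proof.
apply/(in_XbarE _ x); split; last exact: hmeas_sigma.
apply/ultrafilterP; split=> [h []//|h k [_ hx] [_ kx]|h hh]; first by exists x.
have [hx|hx] := pselect (h x); [by left|right].
by split=> //; exact: halfspaceC.
Qed.

(** Two halfspaces that each belong to two of the three ultrafilters share one of them. *)
Lemma medianU_Xbar a b c :
  in_Xbar d a -> in_Xbar d b -> in_Xbar d c -> in_Xbar d (medianU a b c).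
Proof.
move=> Xa; have [_ [x _]] := Xa; move: Xa.
move=> /(in_XbarE _ x)[/ultrafilterP[aH apw aT] am].
move=> /(in_XbarE _ x)[/ultrafilterP[bH bpw bT] bm].
move=> /(in_XbarE _ x)[/ultrafilterP[cH cpw cT] cm].
apply/(in_XbarE _ x); split; last exact: hmeas_medianU.
apply/ultrafilterP; split.
- by move=> h [[[/aH ? _]|[/bH ? _]]|[/cH ? _]].
- move=> h k [[[? ?]|[? ?]]|[? ?]] [[[? ?]|[? ?]]|[? ?]];
    by [exact: apw|exact: bpw|exact: cpw].
- move=> h hh; rewrite /medianU /=.
  by have := aT h hh; have := bT h hh; have := cT h hh; tauto.
Qed.

Section Measure.
Variable nu : set (set X) -> \bar R.
Hypothesis wm : wall_measure d nu.

Lemma nu0 : nu set0 = 0%E. Proof. by have [] := wm. Qed.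

Lemma nu_ge0 A : Bsig A -> (0 <= nu A)%E. Proof. by have [_ + _ _] := wm; apply. Qed.

Lemma nu_hsi x y : nu (hsi x y) = (d x y)%:E. Proof. by have [_ _ _ ] := wm. Qed.

(** Countable additivity for [A], [B] followed by empty sets; the partial sums are constant from
    index 2 on. *)
Lemma nu_U A B : Bsig A -> Bsig B -> A `&` B = set0 ->
  nu (A `|` B) = (nu A + nu B)%E.
Proof.
move=> BA BB AB; have [_ _ sa _] := wm.
have Bi i : Bsig (bigcup2 A B i) by case: i => [|[|i]] //=; exact: Bsig0.
have H := sa _ Bi _; rewrite bigcup2E in H.
apply: (cvg_unique (@ereal_hausdorff R) (H _)).
  apply/trivIsetP => -[|[|i]] [|[|j]] //= _ _ _; rewrite ?setI0 ?set0I//.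
  by rewrite setIC.
apply: cvg_near_cst; exists 2%N => // N /= N2.
rewrite -(subnK N2) addnC big_mkord big_ord_recl /= big_ord_recl /=.
by rewrite big1 ?adde0// => i _; exact: nu0.
Qed.

Lemma nu_le A B : Bsig A -> Bsig B -> A `<=` B -> (nu A <= nu B)%E.
Proof.
move=> BA BB AB; have BD := Bsig_D BB BA.
rewrite -(setDUK AB) nu_U//; last by apply/seteqP; split=> h // [? []].
by rewrite leeDl//; exact: nu_ge0.
Qed.


Lemma nu_le0 A B : Bsig A -> Bsig B -> A `<=` B -> nu B = 0%E -> nu A = 0%E.
Proof.
move=> BA BB AB B0; apply/eqP; rewrite eq_le nu_ge0// andbT -B0.
exact: nu_le.
Qed.

Lemma nu_fin E a b : Bsig E -> nu (E `&` hsi a b) \is a fin_num.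
Proof.
move=> BE; have BI := Bsig_I BE (Bsig_hsi a b).
rewrite ge0_fin_numE ?nu_ge0//.
have /le_lt_trans -> // : (nu (E `&` hsi a b) <= nu (hsi a b))%E.
  by apply: nu_le => //; exact: Bsig_hsi.
by rewrite nu_hsi ltry.
Qed.

(** Without a separating halfspace [hsi x y] is empty, and its measure [d x y] vanishes. *)
Lemma wall_sep x y : x <> y -> exists h, [/\ halfspace h, ~ h x & h y].
Proof.
move=> xy; apply: contrapT => no; apply: xy; apply: d_eq0.
have : hsi x y = set0.
  by apply/seteqP; split=> // h /hsiP H; apply: no; exists h.
by have := nu_hsi x y => + E; rewrite E nu0 => -[].
Qed.

End Measure.

(** Dynkin's pi-lambda argument, run inside one [hsi a b], where both measures are finite. It serves
    to prove invariance of [nu] under the action. *)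
Lemma wall_measure_uniq nu1 nu2 : wall_measure d nu1 -> wall_measure d nu2 ->
  forall E a b, Bsig E -> nu1 (E `&` hsi a b) = nu2 (E `&` hsi a b).
Proof.
move=> w1 w2 E a b BE.
pose H := [set A | Bsig A /\ nu1 (A `&` hsi a b) = nu2 (A `&` hsi a b)].
suff [] : H E by [].
have piG : setI_closed [set A | exists x y, A = hsi x y].
  by move=> _ _ [x [y ->]] [z [t ->]]; rewrite hsi_setI; do 2!eexists.
move: E BE; apply: (lambda_system_subset piG) => //; last exact: Bsig_HS.
  have HSE : HS `&` hsi a b = hsi a b by apply: setIidr => h /hsiP[].
  have HSD : setSD_closed H.
    move=> A B BA [mA eA] [mB eB]; split; first exact: Bsig_D.
    have split nu : wall_measure d nu ->
        nu (A `&` hsi a b) = (nu (B `&` hsi a b) + nu ((A `\` B) `&` hsi a b))%E.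
      move=> w; rewrite -(nu_U w).
      - by rewrite -setIUl setDUK.
      - by apply: Bsig_I => //; exact: Bsig_hsi.
      - by apply: Bsig_I; [exact: Bsig_D|exact: Bsig_hsi].
      - by apply/seteqP; split=> h //= [[? ?] [[]]].
    have fB := nu_fin w2 a b mB.
    have fD1 := nu_fin w1 a b (Bsig_D mA mB).
    have fD2 := nu_fin w2 a b (Bsig_D mA mB).
    have := split _ w1; rewrite eA (split _ w2) eB.
    move: (fineK fB) (fineK fD1) (fineK fD2) => <- <- <-.
    by rewrite -!EFinD => -[] /addrI ->.
  split=> //.
  - by move=> A [/Bsig_HS].
  - split; first by have [] := Bsig_props.
    by rewrite HSE !nu_hsi.
  - move=> F ndF HF; split; first by apply: Bsig_bigcup => i; have [] := HF i.
    have mS i : Bsig (seqD F i) /\ nu1 (seqD F i `&` hsi a b) = nu2 (seqD F i `&` hsi a b).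
      case: i => [|i] /=; first exact: HF.
      by apply: (HSD) => //; apply/subsetPset/ndF.
    rewrite setI_bigcupl.
    have -> : \bigcup_i (F i `&` hsi a b) = \bigcup_i (seqD F i `&` hsi a b).
      by rewrite -!setI_bigcupl eq_bigcup_seqD.
    have mSh i : Bsig (seqD F i `&` hsi a b).
      by apply: Bsig_I; [have [] := mS i|exact: Bsig_hsi].
    have tS : trivIset setT (fun i => seqD F i `&` hsi a b).
      exact/trivIset_setIr/trivIset_seqD.
    have [_ _ /(_ _ mSh tS) c1 _] := w1; have [_ _ /(_ _ mSh tS) c2 _] := w2.
    apply: (cvg_unique (@ereal_hausdorff R) c1).
    rewrite (_ : (fun _ => _) = (fun n0 => \sum_(0 <= i < n0) nu2 (seqD F i `&` hsi a b))%E)//.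
    by apply/funext => N; apply: eq_bigr => i _; have [] := mS i.
move=> _ [x [y ->]]; split; first exact: Bsig_hsi.
by rewrite setIC hsi_setI !nu_hsi.
Qed.

(** * Isometric actions *)
Section Action.
Variables (G : Type) (mul : G -> G -> G) (one : G) (inv : G -> G) (act : G -> X -> X).
Hypothesis ia : isometric_action d mul one inv act.

Local Notation im g C := (act g @` C).

Lemma act_d g x y : d (act g x) (act g y) = d x y.
Proof. by have [_ _ _ _] := ia; apply. Qed.

Lemma act1 x : act one x = x.
Proof. by have [_ _ H _ _] := ia; exact: H. Qed.

Lemma actM g k x : act (mul g k) x = act g (act k x).
Proof. by have [_ _ _ H _] := ia; exact: H. Qed.

Lemma actK g x : act (inv g) (act g x) = x.
Proof. by have [_ [_ H] _ _ _] := ia; rewrite -actM H act1. Qed.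

Lemma actVK g x : act g (act (inv g) x) = x.
Proof. by apply: d_eq0; rewrite -(act_d (inv g)) actK dxx. Qed.

Lemma imE g C x : (im g C) x = C (act (inv g) x).
Proof.
apply/propext; split; first by case=> y Cy <-; rewrite actK.
by move=> H; exists (act (inv g) x) => //; rewrite actVK.
Qed.

Lemma im_act g C x : (im g C) (act g x) = C x.
Proof. by rewrite imE actK. Qed.

Lemma imK g C : im (inv g) (im g C) = C.
Proof. by apply/seteqP; split=> x; rewrite !imE actVK. Qed.

Lemma imVK g C : im g (im (inv g) C) = C.
Proof. by apply/seteqP; split=> x; rewrite !imE actK. Qed.

Lemma imM g k C : im (mul g k) C = im g (im k C).
Proof.
apply/seteqP; split=> x; first by case=> y Cy <-; rewrite actM !im_act.
by case=> _ [y Cy <-] <-; rewrite -actM im_act.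
Qed.

Lemma im1 C : im one C = C.
Proof. by apply/seteqP; split=> x; [case=> y Cy <-; rewrite act1|exists x; rewrite ?act1]. Qed.

Lemma imC g C : im g (~` C) = ~` (im g C).
Proof. by apply/seteqP; split=> x; rewrite setNE !imE. Qed.

Lemma imI g C K : im g (C `&` K) = im g C `&` im g K.
Proof.
apply/seteqP; split=> x; first by rewrite imE => -[? ?]; split; rewrite imE.
by case; rewrite !imE.
Qed.

Lemma im0 g C : im g C !=set0 <-> C !=set0.
Proof.
by split=> -[x]; [case=> y Cy _; exists y|exists (act g x); rewrite im_act].
Qed.

Lemma im_itv g x y z : I (act g x) (act g y) (act g z) = I x y z.
Proof. by rewrite /Defs.interval /= !act_d. Qed.

Lemma im_convex g C : convex C -> convex (im g C).
Proof.
move=> cC _ _ [x Cx <-] [y Cy <-] z.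
by rewrite -(actVK g z) im_itv im_act; exact: cC.
Qed.

Lemma im_halfspace g h : halfspace h -> halfspace (im g h).
Proof.
by case=> *; split; rewrite -?imC; [exact/im0|exact/im0|exact: im_convex|exact: im_convex].
Qed.

Lemma im_transverse g (h k : set X) : transverse h k -> transverse (im g h) (im g k).
Proof. by case=> *; split; rewrite -?imC -imI; exact/im0. Qed.

Lemma im_cl g C : cl (im g C) = im g (cl C).
Proof.
apply/seteqP; split=> x; rewrite imE => H e /H [y].
  by rewrite imE => -[Cy xy]; exists (act (inv g) y); rewrite act_d.
move=> [Cy xy]; exists (act g y); rewrite im_act; split=> //.
by rewrite -(actVK g x) act_d.
Qed.

Lemma im_interior g C x : interior_X d C x -> interior_X d (im g C) (act g x).
Proof.
move=> [e [e0 H]]; exists e; split=> // y; rewrite imE -(actVK g y) act_d actK.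
exact: H.
Qed.

Lemma im_thick g h : thick d h -> thick d (im g h).
Proof.
move=> [hh [x hx] [y hy]]; split; first exact: im_halfspace.
  by exists (act g x); exact: im_interior.
by exists (act g y); rewrite -imC; exact: im_interior.
Qed.

Lemma im_gate g C x p : gate C x p -> gate (im g C) (act g x) (act g p).
Proof.
move=> [Cp H]; split; first by rewrite im_act.
by move=> _ [c Cc <-]; rewrite im_itv; exact: H.
Qed.

Lemma im_hsi g x y h : hsi (act g x) (act g y) (im g h) <-> hsi x y h.
Proof.
rewrite !hsiP !im_act; split=> -[hh ? ?]; split=> //; last exact: im_halfspace.
by rewrite -(imK g h); exact: im_halfspace.
Qed.

Lemma im_strongly_separated g (h k : set X) :
  strongly_separated d h k -> strongly_separated d (im g h) (im g k).
Proof.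
move=> [hh hk H no]; split; [exact: im_halfspace|exact: im_halfspace| |].
  by rewrite !im_cl -imI H image_set0.
case=> j [hj jh jk]; apply: no; exists (im (inv g) j); split.
- exact: im_halfspace.
- by rewrite -(imK g h); exact: im_transverse.
- by rewrite -(imK g k); exact: im_transverse.
Qed.

Lemma act_hsE g s h : act_hs act g s h = s (im (inv g) h).
Proof.
apply/propext; split; first by case=> k sk <-; rewrite imK.
by move=> H; exists (im (inv g) h) => //; rewrite imVK.
Qed.

Lemma act_hs_hsi g x y : act_hs act g (hsi x y) = hsi (act g x) (act g y).
Proof.
apply/seteqP; split=> h; rewrite act_hsE; first by rewrite -(im_hsi g) imVK.
by move=> H; rewrite -(im_hsi g) imVK.
Qed.

Lemma act_hsI g s t : act_hs act g (s `&` t) = act_hs act g s `&` act_hs act g t.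
Proof.
apply/seteqP; split=> h; first by rewrite act_hsE => -[? ?]; split; rewrite act_hsE.
by case; rewrite !act_hsE.
Qed.

Lemma act_hsD g s t : act_hs act g (s `\` t) = act_hs act g s `\` act_hs act g t.
Proof.
apply/seteqP; split=> h.
  by rewrite act_hsE => -[? ?]; split; rewrite act_hsE.
by case; rewrite !act_hsE.
Qed.

Lemma act_hs_HS g : act_hs act g HS = HS.
Proof.
apply/seteqP; split=> h; rewrite act_hsE => H; last exact: im_halfspace.
by rewrite -(imVK g h); exact: im_halfspace.
Qed.

Lemma act_hs_bigcup g (F : nat -> set (set X)) :
  act_hs act g (\bigcup_i F i) = \bigcup_i act_hs act g (F i).
Proof.
apply/seteqP; split=> h; rewrite act_hsE.
  by case=> i _ H; exists i => //; rewrite act_hsE.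
by case=> i _; rewrite act_hsE => H; exists i.
Qed.

Lemma act_hs_Bsig g E : Bsig E -> Bsig (act_hs act g E).
Proof.
move: E; apply: smallest_sub.
  split=> [|A H|F H].
  - rewrite (_ : act_hs _ _ _ = set0); first exact: Bsig0.
    by apply/seteqP; split=> // h; rewrite act_hsE.
  - by rewrite /= act_hsD act_hs_HS; apply: Bsig_D => //; have [] := Bsig_props.
  - by rewrite /= act_hs_bigcup; exact: Bsig_bigcup.
by move=> _ [x [y ->]] /=; rewrite act_hs_hsi; exact: Bsig_hsi.
Qed.

Lemma wall_measure_act nu g : wall_measure d nu ->
  wall_measure d (fun E => nu (act_hs act g E)).
Proof.
move=> w; have [nu0 nu_ge0 nu_sa nu_d] := w; split.
- rewrite (_ : act_hs _ _ _ = set0)//.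
  by apply/seteqP; split=> // h; rewrite act_hsE.
- by move=> A BA; apply: nu_ge0; exact: act_hs_Bsig.
- move=> F BF tF; rewrite act_hs_bigcup; apply: nu_sa.
    by move=> i; exact: act_hs_Bsig.
  apply/trivIsetP => i j _ _ ij; rewrite -act_hsI.
  move/trivIsetP : tF => /(_ i j Logic.I Logic.I ij) ->.
  by apply/seteqP; split=> // h; rewrite act_hsE.
- by move=> x y; rewrite act_hs_hsi nu_d act_d.
Qed.

Lemma act_hs_Xbar g s : in_Xbar d s -> in_Xbar d (act_hs act g s).
Proof.
move=> Xs; have [_ [x _]] := Xs; move: Xs.
move=> /(in_XbarE _ x)[/ultrafilterP[sH spw sT] sm].
apply/(in_XbarE _ x); split; last first.
  move=> a b; rewrite -(actVK g a) -(actVK g b) -act_hs_hsi -act_hsI.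
  by apply: act_hs_Bsig; exact: sm.
apply/ultrafilterP; split.
- move=> h; rewrite act_hsE => /sH H.
  by rewrite -(imVK g h); exact: im_halfspace.
- move=> h k; rewrite !act_hsE => H1 H2.
  by have := spw _ _ H1 H2; rewrite -imI => /im0.
- by move=> h hh; rewrite !act_hsE imC; apply: sT; exact: im_halfspace.
Qed.

(** * Limit points in the Roller compactification *)

(** Projection to [I a b] is monotone as seen from [a], checked on halfspaces. *)
Lemma med_mono a b q q' : I a q' q -> I a (med a b q') (med a b q).
Proof.
move=> aq'q; suff {1}-> : med a b q = med a (med a b q') (med a b q) by exact: medI1.
apply: hs_eq => h hh hm; have hc := hs_convex hh; have hcC := hs_convexC hh.
have [ha|ha] := pselect (h a); first exact: convex_med13.
have [hb hq] := med_hs hh hm ha.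
have hq' : h q' by apply: contrapT => hq'; exact: hcC aq'q hq.
by apply: convex_med23 => //; exact: convex_med23.
Qed.

Lemma Bsig_compl E : Bsig E -> Bsig [set h | E (~` h)].
Proof.
move: E; apply: smallest_sub.
  split=> [|A H|F H] /=; first exact: Bsig0.
    rewrite (_ : mkset _ = HS `\` [set h | A (~` h)]).
      by apply: Bsig_D => //; have [] := Bsig_props.
    apply/seteqP; split=> h [] //= H1 H2; split=> //.
      by rewrite -[h]setCK; exact: halfspaceC.
    exact: halfspaceC.
  rewrite (_ : mkset _ = \bigcup_i [set h | F i (~` h)])//.
  exact: Bsig_bigcup.
move=> _ [x [y ->]] /=; rewrite (_ : mkset _ = hsi y x); first exact: Bsig_hsi.
apply/seteqP; split=> h /=; last exact: hsiC.
by move=> /hsiC; rewrite setCK.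
Qed.

Section LimitPoint.
Context {J : Type} (F : J -> set X) (x : X).
Hypothesis Fcvx : forall i, convex (F i).
Hypothesis Fcl : forall i, cl (F i) `<=` F i.
Hypothesis FF : forall i j, F i `&` F j !=set0.
Variable p : seq J -> X.
Hypothesis pP : forall l, gate (fint F l) x (p l).

(** Halfspaces of [hsi a b] missing [x] are those of [hsi a' b]. For them, containing a gate from
    [x], containing a gate from [a'] and containing the finite intersection are the same. A
    countable cofinal family of gates then gives a countable union. *)
Lemma limit_hmeas a b : Bsig ([set h | ~ h x /\ exists l, h (p l)] `&` hsi a b).
Proof.
pose a' := med a b x.
have /choice [q Hq] : forall l, exists q, gate (fint F l) a' q.
  move=> l; apply: gate_exists => //; first exact: fint_convex.
    exact: fint_closed.
  exact: fint_neq0.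
pose c l := med a' b (q l).
have [|j|k Hk] := @countable_cofinal (seq J) [::] cat c a' b.
- by move=> i j; split; apply: med_mono; apply: (gateS _ (Hq _) (Hq _));
    rewrite fint_cat; [exact: subIsetl|exact: subIsetr].
- exact: medI1.
rewrite (_ : _ `&` _ = \bigcup_i hsi a' (c (k i))).
  by apply: Bsig_bigcup => i; exact: Bsig_hsi.
apply/seteqP; split=> h.
  move=> [[hx [l hp]] hab].
  have : (hsi a b `&` [set h | ~ h x]) h by [].
  rewrite hsi_notin => /hsiP[hh ha' hb].
  have Kh := gate_hs (pP l) hh hx hp; have hq : h (q l) by apply: Kh; have [] := Hq l.
  have [|i hi] := Hk h l hh ha'; first exact: (convex_med23 _ (hs_convex hh)).
  by exists i => //; apply/hsiP.
move=> [i _ /hsiP[hh ha' hc]].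
have [hb hq] := med_hs hh hc ha'.
have : hsi a' b h by apply/hsiP.
rewrite -hsi_notin => -[hab hx]; split=> //; split=> //.
exists (k i); apply: (gate_hs (Hq _) hh ha' hq); by have [] := pP (k i).
Qed.

(** The limit of [sigma_pt (p l)] along the net: by [gate_hs], a wall once crossed by the gates is
    never crossed back, so eventual membership means always for halfspaces containing [x] and once
    for the others. *)
Definition limit_point : set (set X) := [set h | halfspace h /\
  ((h x /\ forall l, h (p l)) \/ (~ h x /\ exists l, h (p l)))].

(** Expresses that the limit lies in every [F i]. A gate [p l'] outside [h] would put [fint F l']
    outside [h], yet it meets [fint F l]. *)
Lemma limit_point_fint h l : halfspace h -> fint F l `<=` h -> limit_point h.
Proof.
move=> hh Kh; split=> //; have [hx|hx] := pselect (h x); last first.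
  by right; split=> //; exists l; apply: Kh; have [] := pP l.
left; split=> // l'; apply: contrapT => hp.
have K'h := gate_hs (pP l') (halfspaceC hh) (fun H => H hx) hp.
have [y] := @fint_neq0 _ _ Fcvx (l ++ l') x FF.
by rewrite fint_cat => -[/Kh hy /K'h].
Qed.

Lemma limit_point_Xbar : in_Xbar d limit_point.
Proof.
apply/(in_XbarE _ x); split; last first.
  move=> a b; pose P : set (set X) := [set h | ~ h x /\ exists l, h (p l)] `&` hsi a b.
  (* Halfspaces containing [x] that some gate leaves. *)
  pose N := [set h | ([set h | ~ h x /\ exists l, h (p l)] `&` hsi b a) (~` h)].
  have -> : limit_point `&` hsi a b = ((sigma_pt x `&` hsi a b) `\` N) `|` P.
    apply/seteqP; split=> h.
      move=> [[hh [[hx hp]|[hx hp]]] hab]; last by right.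
      by left; split=> // -[[_ [l hl]] _]; exact: hl (hp l).
    case=> [[[[hh hx] hab] hN]|[[hx hp] hab]]; last first.
      by have /hsiP[hh _ _] := hab; split=> //; split=> //; right.
    split=> //; split=> //; left; split=> // l; apply: contrapT => hp.
    by apply: hN; split; [split; [exact: (fun H => H hx)|exists l]|exact: hsiC].
  apply: Bsig_U; last exact: (limit_hmeas a b).
  apply: Bsig_D; first exact: hmeas_sigma.
  by apply: Bsig_compl; exact: limit_hmeas.
have ev h : limit_point h -> exists l0, forall l, fint F l `<=` fint F l0 -> h (p l).
  move=> [hh [[_ hp]|[hx [l0 hp]]]]; first by exists [::].
  exists l0 => l Kl; apply: (gate_hs (pP l0) hh hx hp); apply: Kl.
  by have [] := pP l.
apply/ultrafilterP; split; first by move=> h [].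
  move=> h k /ev[l0 H0] /ev[l1 H1]; exists (p (l0 ++ l1)).
  by split; [apply: H0|apply: H1]; rewrite fint_cat; [exact: subIsetl|exact: subIsetr].
move=> h hh; have hhC := halfspaceC hh.
have [hx|hx] := pselect (h x).
  have [hp|/existsNP[l hp]] := pselect (forall l, h (p l)).
    by left; split=> //; left.
  by right; split=> //; right; split; [exact: (fun H => H hx)|exists l].
have [hp|/forallNP hp] := pselect (exists l, h (p l)).
  by left; split=> //; right.
by right; split=> //; left.
Qed.

End LimitPoint.

(** * Flipping and skewering *)
Section Flip.
Variable nu : set (set X) -> \bar R.
Hypothesis wm : wall_measure d nu.
Hypothesis rm : roller_minimal d act nu.

Lemma Bsig_hsiD x y s : hmeas s -> Bsig (hsi x y `\` s).
Proof.
move=> Hs; rewrite (_ : _ `\` _ = hsi x y `\` (s `&` hsi x y)).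
  by apply: Bsig_D => //; exact: Bsig_hsi.
by apply/seteqP; split=> h; rewrite /setD /setI /=; tauto.
Qed.

Lemma nuU_null A N : Bsig A -> Bsig N -> nu N = 0%E -> nu (A `|` N) = nu A.
Proof.
move=> BA BN N0; have BD := Bsig_D BN BA.
rewrite (_ : _ `|` _ = A `|` (N `\` A)); last first.
  by apply/seteqP; split=> h; rewrite /setU /setD /=; have [] := pselect (A h); tauto.
rewrite (nu_U wm)//; last by apply/seteqP; split=> h // [? []].
by rewrite (nu_le0 wm BD BN (@subDsetl _ _ _) N0) adde0.
Qed.

Lemma nu_eq_null A B N : Bsig A -> Bsig B -> Bsig N -> nu N = 0%E ->
  A `<=` B `|` N -> B `<=` A `|` N -> nu A = nu B.
Proof.
move=> BA BB BN N0 AB BA'; apply/eqP; rewrite eq_le.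
rewrite -{1}(nuU_null BB BN N0) -{2}(nuU_null BA BN N0).
by rewrite !(nu_le wm)//; exact: Bsig_U.
Qed.

Lemma Xbar_eq_null s t x y : hmeas s -> hmeas t -> Xbar_eq d nu s t ->
  nu (symdiff s t `&` hsi x y) = 0%E.
Proof.
move=> ms' mt H; have mst := hmeas_symdiff ms' mt.
apply/eqP; rewrite eq_le (nu_ge0 wm)// andbT -[X in (_ <= X)%E]H.
by apply: ereal_sup_ubound; exists x => //; exists y.
Qed.

(** On [hsi x p] the median with [sigma_pt x] and [sigma_pt p] is [s] itself, so up to a null set
    the halfspaces counted are those separating [z] from [p]. *)
Lemma proj_dist s x p z : hmeas s -> Defs.proj d nu x p s z ->
  nu (hsi x p `\` s) = (d z p)%:E.
Proof.
move=> sm [xpz H]; rewrite -(nu_hsi wm).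
have sx := hmeas_sigma x; have sp := hmeas_sigma p; have sz := hmeas_sigma z.
have mM := hmeas_medianU sx sp sm.
apply: (nu_eq_null _ _ _ (Xbar_eq_null x p mM sz H)).
- exact: Bsig_hsiD.
- exact: Bsig_hsi.
- exact: hmeas_symdiff.
- move=> h [hxp hs]; have /hsiP[hh hx hp] := hxp.
  have [hz|hz] := pselect (h z); last by left; apply/hsiP.
  right; split=> //; right; split=> //.
  by case=> [[[[]]//|[_ /hs]]|[/hs]].
- move=> h hzp; have hxp : hsi x p h.
    have /hsiP[hh hz hp] := hzp; apply/hsiP; split=> // hx; apply: hz.
    exact: (hs_convex hh hx hp).
  have /hsiP[hh hz hp] := hzp.
  have [hs|hs] := pselect (s h); last by left.
  right; split=> //; left; split; last by case.
  by left; right; split.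
Qed.

(* Otherwise the translates of [cl h] pairwise intersect, and the points of the
   Roller compactification lying in all of them violate minimality. *)
Lemma flip h : thick d h -> exists g, im g (cl h) `&` cl h = set0.
Proof.
move=> [hh _ [y0 /interior_not_cl y0h]]; apply: contrapT => /forallNP no.
have Kc := cl_convex (hs_convex hh).
pose F g := im g (cl h).
have Fc g : convex (F g) by exact: im_convex.
have Fcl g : cl (F g) `<=` F g.
  by rewrite im_cl; apply: image_subset; exact: cl_cl.
have FF g k : F g `&` F k !=set0.
  rewrite /F -[im g _](imVK k) -(imM (inv k)) -imI; apply/im0.
  by apply: contrapT => /nonemptyPn; exact: no.
(* Membership in all translates of the closure is stated by measure, hence respects [Xbar_eq]:
   almost every halfspace between a point and its gate must be in [s]. *)
pose C : set (set (set X)) := [set s | in_Xbar d s /\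
  forall g x p, gate (F g) x p -> nu (hsi x p `\` s) = 0%E].
have Cm s : C s -> hmeas s by case=> Xs _; have /(in_XbarE _ y0)[] := Xs.
suff CX : forall s, in_Xbar d s -> C s.
  (* If [C] were everything, [y0] would coincide with its gate in [cl h]. *)
  have [p Hp] : exists p, gate (F one) y0 p.
    by apply: gate_exists => //; have [y []] := FF one one; exists y.
  have [_ /(_ _ _ _ Hp)] := CX _ (sigma_pt_Xbar y0).
  rewrite (_ : _ `\` _ = hsi y0 p).
    rewrite (nu_hsi wm) => -[/d_eq0 E]; apply: y0h.
    by have [+ _] := Hp; rewrite -E /F im1.
  by apply/seteqP; split=> k; [case|move=> H; have /hsiP[_ ky _] := H; split=> // -[]].
have [_ /(_ C)] := rm; apply.
- split; first by move=> s [].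
  move=> s t Cs Xt st; split=> // g x p Hp; have sm := Cm _ Cs.
  have /(in_XbarE _ y0)[_ tm] := Xt.
  have [_ /(_ _ _ _ Hp) <-] := Cs.
  apply: (nu_eq_null _ _ _ (Xbar_eq_null x p sm tm st)).
  + exact: Bsig_hsiD.
  + exact: Bsig_hsiD.
  + exact: hmeas_symdiff.
  + move=> k [kxp kt]; have [ks|ks] := pselect (s k); last by left.
    by right; split=> //; left.
  + move=> k [kxp kt]; have [ks|ks] := pselect (t k); last by left.
    by right; split=> //; right.
- move=> s Xs nCs.
  have /existsNP[g /existsNP[x /existsNP[p /not_implyP[Hp Hs]]]] :
      ~ forall g x p, gate (F g) x p -> nu (hsi x p `\` s) = 0%E.
    by move=> H; apply: nCs.
  have /(in_XbarE _ y0)[_ sm] := Xs.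
  have cE : (fine (nu (hsi x p `\` s)))%:E = nu (hsi x p `\` s).
    rewrite fineK// (_ : _ `\` _ = (hsi x p `\` s) `&` hsi x p).
      by apply: (nu_fin wm); exact: Bsig_hsiD.
    by apply/esym/setIidl; exact: subDsetl.
  move: cE; set c := fine _ => cE.
  (* One projection suffices: that of [s] to [I x p] is at distance [c] from [p], while that of a
     member of [C] is [p]. *)
  exists 1%N, (fun _ => x), (fun _ => p), c; split.
    rewrite -lte_fin cE lt_neqAle (nu_ge0 wm) ?andbT; last exact: Bsig_hsiD.
    by apply/eqP => E; apply: Hs.
  move=> t Xt /(_ 0%N isT) [z [z' [zs zt zz']]] Ct.
  have := proj_dist (Cm _ Ct) zt; have [_ /(_ _ _ _ Hp) ->] := Ct => -[E].
  have := proj_dist sm zs; rewrite -cE => -[E'].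
  by have := dT z' z p; lra.
- move=> a b c Ca Cb Xc; split.
    by apply: medianU_Xbar => //; [case: Ca|case: Cb].
  move=> g x p Hp; have am := Cm _ Ca; have bm := Cm _ Cb.
  have /(in_XbarE _ y0)[_ cm] := Xc.
  have := nuU_null (Bsig_hsiD x p am) (Bsig_hsiD x p bm) (Cb.2 _ _ _ Hp).
  rewrite (Ca.2 _ _ _ Hp); apply: (nu_le0 wm).
  + by apply: Bsig_hsiD; exact: hmeas_medianU.
  + by apply: Bsig_U; exact: Bsig_hsiD.
  + move=> k [kxp kM]; have [ka|ka] := pselect (a k); last by left.
    by right; split=> // kb; apply: kM; left; left.
- move=> g s Cs; have [Xs Hs] := Cs; split; first exact: act_hs_Xbar.
  move=> g0 x p Hp.
  (* The gate is pulled back by [inv g]; uniqueness of the measure keeps the translated null set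
     null. *)
  have := im_gate (inv g) Hp; rewrite /F -imM => /Hs E.
  rewrite -(actVK g x) -(actVK g p) -act_hs_hsi -act_hsD.
  have mE := Bsig_hsiD (act (inv g) x) (act (inv g) p) (Cm _ Cs).
  have := wall_measure_uniq wm (wall_measure_act g wm) (act (inv g) x) (act (inv g) p) mE.
  by rewrite setIidl ?E//; exact: subDsetl.
have /choice [p Hp] : forall l, exists p, gate (fint F l) y0 p.
  move=> l; apply: gate_exists => //; first exact: fint_convex.
    exact: fint_closed.
  exact: fint_neq0.
exists (limit_point y0 p); split; first exact: (limit_point_Xbar Fc Fcl FF Hp).
move=> g x q Hq; rewrite (_ : _ `\` _ = set0) ?(nu0 wm)//.
apply/seteqP; split=> // k [/hsiP[hk kx kq]]; apply.
apply: (limit_point_fint Fc FF Hp (l := [:: g])) => //= z [Fz _].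
exact: (gate_hs Hq hk kx kq).
Qed.

(** Double skewering: [a] flips [j] into the complement of [k], and [b] flips that complement into
    [k]. *)
Lemma skewer (k j : set X) : thick d k -> thick d j -> k `<=` j ->
  exists g, im g j `<=` k /\ cl (im g j) `&` cl (~` k) = set0.
Proof.
move=> tk tj kj; have [a Ha] := flip tj; have [b Hb] := flip (thickC tk).
have H1 : im a j `<=` ~` k.
  move=> x jx kx; suff : set0 x by []; rewrite -Ha; split.
    by rewrite -im_cl; exact: sub_cl.
  by apply: sub_cl; exact: kj.
have H2 : im (mul b a) j `<=` im b (~` k) by rewrite imM; exact: image_subset.
have H3 : im b (cl (~` k)) `<=` k.
  move=> x Hx; apply: contrapT => kx; suff : set0 x by []; rewrite -Hb; split=> //.
  exact: sub_cl.
exists (mul b a); split.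
  by move=> x /H2 Hx; apply: H3; rewrite -im_cl; exact: sub_cl.
apply/seteqP; split=> // x [/(clS H2)]; rewrite im_cl => Hx Hx'.
by rewrite -Hb.
Qed.

(** * Sectors and the two types of thick halfspaces *)

Definition big C := exists2 k, thick d k & k `<=` C.

Lemma bigS C K : C `<=` K -> big C -> big K.
Proof. by move=> CK [k tk kC]; exists k => //; exact: subset_trans kC CK. Qed.

Let pw g i := iter i (mul g) one.

Let pwD g i j C : im (pw g (i + j)) C = im (pw g i) (im (pw g j) C).
Proof.
elim: i => [|i IH]; first by rewrite /pw add0n /= im1.
by rewrite addSn ![pw g _.+1]iterS !imM IH.
Qed.

(** Skewer [j] into [k] by [g]. By finite rank some positive power of [g] moves [a] to a halfspace
    not transverse to [a]; the inverse power moves [a] into the complement of [j], hence into one of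
    the two sectors there. *)
Lemma big_sector_step (j a k : set X) : thick d j -> thick d a -> transverse j a ->
  thick d k -> k `<=` j -> k `<=` ~` a ->
  big (~` j `&` ~` a) \/ big (~` j `&` a).
Proof.
move=> tj ta ja tk kj ka; have [g [gjk _]] := skewer tk tj kj.
have pj m : im (pw g m) j `<=` j /\ im (pw g m.+1) j `<=` k.
  elim: m => [|m [IH1 IH2]]; first by rewrite /pw /= im1 imM im1; split.
  split; first exact: subset_trans IH2 kj.
  rewrite -[m.+2]add1n pwD {1}/pw /= imM im1; apply: subset_trans gjk.
  by apply: image_subset; exact: subset_trans kj.
have [m [m0 nt]] : exists m, (0 < m)%N /\ ~ transverse a (im (pw g m) a).
  apply: contrapT => /forallNP no.
  have tr i l : (i < l)%N -> transverse (im (pw g i) a) (im (pw g l) a).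
    move=> il; rewrite -(subnKC (ltnW il)) pwD; apply: im_transverse.
    apply: contrapT => nt; apply: (no (l - i)%N); split=> //.
    by rewrite subn_gt0.
  suff : (n.+1 <= n)%N by rewrite ltnn.
  apply: (rk (f := fun i => im (pw g i) a)) => [i _|i l _ _ il].
    by apply: im_halfspace; exact: thick_hs.
  case: (ltngtP i l) il => [/tr//|/tr/transverseC//|->//].
case: m m0 nt => // m _; set u := pw g m.+1 => nt.
pose a' := im (inv u) a; have ta' : thick d a' by exact: im_thick.
have a'j : a' `<=` ~` j.
  move=> _ [x ax <-] jx; apply: (ka x) => //; apply: (pj m).2.
  by rewrite -/u -(actVK u x) im_act.
have nt' : ~ transverse a' a.
  by move=> /(im_transverse u); rewrite imVK.
have [[x [jx ax]] _ _ [y [jy ay]]] := transverseCl ja.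
have [[z [jz az]] [t [jt at_]] _ _] := ja.
have [E|E|E|E] := not_transverse nt'.
- left; exists a' => // w a'w; split; first exact: a'j.
  by move=> aw; suff : set0 w by []; rewrite -E.
- right; exists a' => // w a'w; split; first exact: a'j.
  by apply: contrapT => aw; suff : set0 w by []; rewrite -E.
- suff : set0 z by []; rewrite -E; split=> // a'z; exact: a'j jz.
- suff : set0 t by []; rewrite -E; split=> // a't; exact: a'j jt.
Qed.

Let sgn (e : bool) (A : set X) := if e then A else ~` A.

(** Crossing each of the two walls by [big_sector_step] reaches either the opposite sector or both
    neighbours, which are opposite to each other. *)
Lemma big_sector_opp (j h : set X) e e' : thick d j -> thick d h -> transverse j h ->
  big (sgn e j `&` sgn e' h) ->
  exists e, big (sgn e j `&` h) /\ big (sgn (~~ e) j `&` ~` h).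
Proof.
have main (i l : set X) : thick d i -> thick d l -> transverse i l -> big (i `&` ~` l) ->
    big (~` i `&` l) \/ (big (i `&` l) /\ big (~` i `&` ~` l)).
  move=> ti tl il [k tk kil].
  have H1 := big_sector_step ti tl il tk (fun x kx => (kil x kx).1) (fun x kx => (kil x kx).2).
  have li : transverse (~` l) (~` i) by apply: transverseCl; apply: transverseCr; exact: transverseC.
  have := big_sector_step (thickC tl) (thickC ti) li tk (fun x kx => (kil x kx).2) _.
  by rewrite !setCK => /(_ (fun x kx => (kil x kx).1)); rewrite ![l `&` _]setIC; tauto.
move=> tj th jh; case: e e' => -[] /= H.
- have := main j (~` h) tj (thickC th) (transverseCr jh); rewrite setCK => /(_ H)[?|[? ?]].
    by exists true.
  by exists false; rewrite /= .
- have [?|[? ?]] := main j h tj th jh H; first by exists false.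
  by exists true.
- have := main (~` j) (~` h) (thickC tj) (thickC th) (transverseCl (transverseCr jh)).
  rewrite !setCK => /(_ H)[?|[? ?]]; first by exists false.
  by exists true.
- have := main (~` j) h (thickC tj) th (transverseCl jh).
  rewrite !setCK => /(_ H)[?|[? ?]]; first by exists true.
  by exists false.
Qed.

(** * Separated thick pairs and the rank of the class crossing both *)

Definition sep_pair (a b : set X) := [/\ thick d a, thick d b & cl a `&` cl b = set0].

Definition crossing (a b j : set X) := [/\ thick d j, transverse j a & transverse j b].

(** The class [P] has rank at least [r]. *)
Definition has_family (P : set X -> Prop) r := exists f : nat -> set X,
  (forall i, (i < r)%N -> P (f i)) /\
  (forall i j, (i < r)%N -> (j < r)%N -> i <> j -> transverse (f i) (f j)).

Lemma crossingC a b j : crossing a b j -> crossing a b (~` j).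
Proof. by case=> *; split; [exact: thickC|exact: transverseCl|exact: transverseCl]. Qed.

Lemma sep_pair_disj a b : sep_pair a b -> a `<=` ~` b.
Proof.
case=> _ _ H x ax bx; suff : set0 x by [].
by rewrite -H; split; exact: sub_cl.
Qed.

Lemma sep_pairS a b a' b' : sep_pair a b -> thick d a' -> thick d b' ->
  a' `<=` a -> b' `<=` b -> sep_pair a' b'.
Proof.
move=> [_ _ H] ta tb aa bb; split=> //; apply/seteqP; split=> // x [xa xb].
by rewrite -H; split; [exact: clS xa|exact: clS xb].
Qed.

Section MinimalFamilies.
Variable r : nat.
Hypothesis allr : forall a b, sep_pair a b -> has_family (crossing a b) r.

(** Thick [x] in [j] and [a], and [y] in [b] off [j], form a separated pair, so [r] transverse
    halfspaces cross both. They also cross [a], [b] and [j]; adding [j] exceeds the rank of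
    [crossing a b]. *)
Lemma opposite_sectors a b j : sep_pair a b -> ~ has_family (crossing a b) r.+1 ->
  crossing a b j -> big (j `&` a) -> ~ big (~` j `&` b).
Proof.
move=> ab nof cj [x tx xja] [y ty yjb]; apply: nof.
have xj : x `<=` j by move=> w /xja[].
have xa : x `<=` a by move=> w /xja[].
have yj : y `<=` ~` j by move=> w /yjb[].
have yb : y `<=` b by move=> w /yjb[].
have [f [Hf ff]] := allr (sep_pairS ab tx ty xa yb).
have ba : b `<=` ~` a by move=> w bw aw; exact: (sep_pair_disj ab aw).
exists (fun i => if i is i'.+1 then f i' else j).
have fj i : (i < r)%N -> transverse (f i) j.
  by move=> /Hf[_ fx fy]; exact: transverse_between fx fy xj yj.
split=> [[|i]|[|i] [|k]] //=; rewrite ?ltnS.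
- move=> /Hf[tf fx fy]; split=> //.
    by apply: (transverse_between fx fy xa) => w yw; apply: ba; exact: yb.
  apply: transverseC; apply: transverseC.
  by apply: (transverse_between fy fx yb) => w xw; apply: (sep_pair_disj ab); exact: xa.
- by move=> _ kr _; apply: transverseC; exact: fj.
- by move=> ir _ _; exact: fj.
- by move=> ir kr ik; apply: ff => // E; apply: ik; rewrite E.
Qed.

(* In the application [a1 = g a] and [~` b] are consecutive with [a] in a chain
   skewered by [g], so both gaps realize the minimal rank [r]. *)
Variables (a1 a b : set X).
Hypothesis (pab : sep_pair a b) (paa : sep_pair a1 (~` a)).
Hypothesis (nab : ~ has_family (crossing a b) r.+1).
Hypothesis (naa : ~ has_family (crossing a1 (~` a)) r.+1).

Let a1a : a1 `<=` a.
Proof. by have := sep_pair_disj paa; rewrite setCK. Qed.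

Let ba : b `<=` ~` a.
Proof. by move=> w bw aw; exact: (sep_pair_disj pab aw). Qed.

Let crossing_mid j : crossing a1 b j -> transverse j a.
Proof. by case=> _ ja jb; exact: transverse_between ja jb a1a ba. Qed.

(** Two opposite sectors at [a] would be big. Transporting them to [a1] and [b] by [big_sector_opp],
    every outcome contradicts [opposite_sectors] for [(a, b)] or for [a1] and the complement of
    [a]. *)
Lemma crossing_no_big_mid j e e' : crossing a1 b j -> ~ big (sgn e j `&` sgn e' a).
Proof.
move=> cj; have [_ ta1 tb] : [/\ thick d a, thick d a1 & thick d b].
  by have [? ? _] := pab; have [? _ _] := paa.
have ta : thick d a by have [] := pab.
suff no i : crossing a1 b i -> big (~` i `&` a) -> ~ big (i `&` ~` a).
  have [tj _ _] := cj; move=> /(big_sector_opp tj ta (crossing_mid cj))[[] /= [H1 H2]].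
    by apply: (no _ (crossingC cj)); rewrite ?setCK.
  exact: (no _ cj).
move=> ci; have tia := crossing_mid ci; have [ti ia1 ib] := ci.
have ciab : crossing a b i by split.
have ciaa : crossing a1 (~` a) i by split=> //; exact: transverseCr.
move=> Q0 P0.
have P1 : big (sgn true i `&` sgn false a1).
  by apply: bigS P0 => w [? aw]; split=> // /a1a.
have [[] /= [H1 H2]] := big_sector_opp ti ta1 ia1 P1; last first.
  by apply: (opposite_sectors paa naa (crossingC ciaa) H1); rewrite setCK.
have Qm : big (sgn false i `&` sgn false b).
  by apply: bigS Q0 => w [? aw]; split=> // /ba.
have [[] /= [H3 H4]] := big_sector_opp ti tb ib Qm.
  by apply: (opposite_sectors pab nab (crossingC ciab) Q0); rewrite setCK.
apply: (opposite_sectors paa naa ciaa H1).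
by apply: bigS H3 => w [? /ba].
Qed.

Lemma crossing_closed j k : crossing a1 b j -> thick d k -> ~ transverse k j ->
  crossing a1 b k.
Proof.
suff main i l : crossing a1 b i -> thick d l -> l `<=` i -> crossing a1 b l.
  move=> cj tk /not_transverse[E|E|E|E].
  - apply: (main (~` j)) => //; first exact: crossingC.
    by move=> x kx jx; suff : set0 x by []; rewrite -E.
  - apply: (main j) => //.
    by move=> x kx; apply: contrapT => jx; suff : set0 x by []; rewrite -E.
  - rewrite -[k]setCK; apply: crossingC; apply: (main (~` j)); [exact: crossingC|exact: thickC|].
    by move=> x kx jx; suff : set0 x by []; rewrite -E.
  - rewrite -[k]setCK; apply: crossingC; apply: (main j) => //; first exact: thickC.
    by move=> x kx; apply: contrapT => jx; suff : set0 x by []; rewrite -E.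
move=> ci tl li; have [ti ia1 ib] := ci.
have ta1 : thick d a1 by have [] := paa.
have tb : thick d b by have [] := pab.
(* Were [l] not transverse to [h], it would lie in a sector of [i] and [h]; [big_sector_opp] then
   gives a big sector inside [h]. *)
have tr h : thick d h -> transverse i h ->
    (forall e, big (sgn e i `&` h) -> False) -> transverse l h.
  move=> th ih nob; apply: contrapT => nt.
  have nob' e e' : ~ big (sgn e i `&` sgn e' h).
    by move=> /(big_sector_opp ti th ih)[e1 [/nob]].
  have [_ _ [x [ix hx]] [y [iy hy]]] := ih.
  have [E|E|E|E] := not_transverse nt.
  - apply: (nob' true false); exists l => // w lw; split; first exact: li.
    by move=> hw; suff : set0 w by []; rewrite -E.
  - apply: (nob' true true); exists l => // w lw; split; first exact: li.
    by apply: contrapT => hw; suff : set0 w by []; rewrite -E.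
  - by suff : set0 x by []; rewrite -E; split=> // /li.
  - by suff : set0 y by []; rewrite -E; split=> // /li.
split=> //; apply: tr => // e H.
- apply: (crossing_no_big_mid (e := e) (e' := true) ci).
  by apply: bigS H => w [? /a1a].
- apply: (crossing_no_big_mid (e := e) (e' := false) ci).
  by apply: bigS H => w [? /ba].
Qed.

End MinimalFamilies.

Lemma thick_exists : exists h, thick d h.
Proof.
have [[x [y /robust_sep[h [hh hx hy]]]] _] := rm.
by exists h; exact: robust_thick hh hx hy.
Qed.

Lemma crossing_dichotomy :
  (exists a b, sep_pair a b /\ forall j, ~ crossing a b j) \/
  (exists P : set X -> Prop, [/\ exists2 j, thick d j & P j,
    exists2 k, thick d k & ~ P k &
    forall j k, thick d j -> thick d k -> P j -> ~ P k -> transverse j k]).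
Proof.
have [|H] := pselect (exists a b, sep_pair a b /\ forall j, ~ crossing a b j); first by left.
right; have ex a b : sep_pair a b -> exists j, crossing a b j.
  move=> ab; apply: contrapT => /forallNP no; apply: H; by exists a, b.
pose Q r := forall a b, sep_pair a b -> has_family (crossing a b) r.
(* The least rank [r] of a crossing class, attained at [(a, b)]; a flipped thick halfspace provides
   a separated pair, so finite rank bounds [r]. *)
have [r [Qr /existsNP[a /existsNP[b /not_implyP[ab nab]]]]] : exists r, Q r /\ ~ Q r.+1.
  apply: contrapT => /forallNP no.
  have Qall r : Q r.
    elim: r => [a b _|r IH]; first by exists (fun _ => set0).
    by apply: contrapT => nQ; apply: (no r).
  have [h th] := thick_exists; have [g gh] := flip th.
  have [|f [Hf ff]] := Qall n.+1 (im g h) h.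
    by split=> //; [exact: im_thick|rewrite im_cl].
  suff : (n.+1 <= n)%N by rewrite ltnn.
  by apply: (rk (f := f)) ff => i /Hf[/thick_hs].
have [ta tb clab] := ab.
have adb := sep_pair_disj ab.
have [g [gba gcl]] := skewer ta (thickC tb) adb.
pose a1 := im g a; have ta1 : thick d a1 by exact: im_thick.
have a1gb : a1 `<=` im g (~` b) by exact: image_subset.
have a1a : a1 `<=` a by exact: subset_trans gba.
have paa : sep_pair a1 (~` a).
  split=> //; first exact: thickC.
  by apply/seteqP; split=> // x [xa1 xa]; rewrite -gcl; split=> //; exact: clS xa1.
(* What crosses [im g a] and the complement of [a] also crosses [im g b]; pulled back by [g], it
   crosses [a] and [b]. *)
have naa : ~ has_family (crossing a1 (~` a)) r.+1.
  move=> [f [Hf ff]]; apply: nab; exists (fun i => im (inv g) (f i)); split.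
    move=> i /Hf[tf fa1 fa]; split; first exact: im_thick.
      by rewrite -[X in transverse _ X](imK g); exact: im_transverse.
    rewrite -[X in transverse _ X](imK g); apply: im_transverse.
    rewrite -[im g b]setCK -imC; apply: transverseCr.
    by apply: (transverse_between fa1 fa a1gb) => x ax /gba.
  by move=> i k ir kr ik; apply: im_transverse; exact: ff.
have [j cj] : exists j, crossing a1 b j.
  by apply: ex; exact: sep_pairS ab _ _ a1a _.
exists (crossing a1 b); split.
- by exists j => //; have [] := cj.
- by exists a => // -[_ [_ _ [y [nay /a1a ay]] _] _]; exact: nay ay.
move=> k l tk tl ck ncl; apply: transverseC; apply: contrapT => nt; apply: ncl.
exact: (crossing_closed Qr ab paa nab naa ck).
Qed.

(** * Splitting *)

Lemma median_sub (S : X -> Prop) :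
  (forall x y z, S x -> S y -> S z -> S (med x y z)) ->
  median_space (fun u v : {x | S x} => d (sval u) (sval v)).
Proof.
have inj (u v : {x | S x}) : sval u = sval v -> u = v.
  by apply: eq_sig_hprop => x p q; exact: Prop_irrelevance.
move=> Sm; split.
  split=> [x y|x y|x y z]; [|exact: dC|exact: dT].
  by split=> [/d_eq0/inj//|->]; exact: dxx.
move=> [x Sx] [y Sy] [z Sz]; exists (exist _ _ (Sm _ _ _ Sx Sy Sz)); split.
  by have [] := medP x y z; split.
by move=> [m Sm'] /= [H1 [H2 H3]]; apply: inj; apply/esym/med_uniq => //; exact: itvC.
Qed.

(* Symmetric and transitive when [T] is closed under non-transversality: a halfspace
   [h] with [h x] and [~ cl h y] can be replaced by a larger one of type [T] for which
   neither point is adherent to the opposite side. *)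
Definition eqv (T : set X -> Prop) x y :=
  forall h, thick d h -> T h -> h x -> cl h y.

Section Eqv.
Variable T : set X -> Prop.
Hypothesis Tcl : forall j k, thick d j -> thick d k -> T j -> ~ transverse j k -> T k.

Lemma not_transverseC h : ~ transverse h (~` h).
Proof. by case=> -[x []]. Qed.

(** [l] robustly separates [x] from its gate in [cl h]. It contains [h], so it is not transverse to
    [h] and inherits its type. *)
Lemma eqv_robust h p x : thick d h -> T h -> h p -> ~ cl h x ->
  exists l, [/\ thick d l, T l, T (~` l), ~ cl l x & ~ cl (~` l) p].
Proof.
move=> th Th hp hx; have hh := thick_hs th.
have [|||q Hq] := @gate_exists cpl (cl h) x.
- by apply: cl_convex; exact: hs_convex.
- exact: cl_cl.
- by exists p; exact: sub_cl.
have xq : x <> q by move=> E; apply: hx; rewrite E; have [] := Hq.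
have [l [hl lx lq]] := robust_sep xq.
have tl : thick d l by exact: robust_thick hl lx lq.
have hsub : cl h `<=` l.
  apply: (gate_hs Hq hl); first by move=> /sub_cl.
  by apply: contrapT => H; apply: lq; exact: sub_cl.
have Tl : T l.
  apply: (Tcl th tl Th) => -[_ [y [hy ly]] _ _].
  by apply: ly; apply: hsub; exact: sub_cl.
exists l; split => //; first by apply: (Tcl tl (thickC tl) Tl); exact: not_transverseC.
move=> lp; apply: lq => e e0; have [y [ly py]] := lp _ e0.
(* A point [y] off [l] near [p] projects to a point off [l] near the gate [q], since [q] is between
   [x] and [p]. *)
exists (med x q y); split.
  by apply: (convex_med13 _ (hs_convexC hl) _ ly) => /sub_cl.
have := med_dist2 x q y; have := Hq.2 _ (sub_cl hp); rewrite /Defs.interval /=.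
have := dT p q y; have := dT y x p; rewrite (dC y p); lra.
Qed.

Lemma eqv_sym x y : eqv T x y -> eqv T y x.
Proof.
move=> xy h th Th hy; apply: contrapT => hx.
have [l [tl Tl TlC lx ly]] := eqv_robust th Th hy hx.
by apply: ly; apply: (xy _ (thickC tl) TlC) => /sub_cl.
Qed.

Lemma eqv_trans y x z : eqv T x y -> eqv T y z -> eqv T x z.
Proof.
move=> xy yz h th Th hx; apply: contrapT => hz.
have [l [tl Tl TlC lz lx]] := eqv_robust th Th hx hz.
have [ly|ly] := pselect (l y); first by apply: lz; exact: (yz _ tl Tl ly).
by apply: lx; exact: (eqv_sym xy (thickC tl) TlC ly).
Qed.

Lemma eqv_med o x y z : eqv T o x -> eqv T o y -> eqv T o z -> eqv T o (med x y z).
Proof.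
move=> /eqv_sym ox /eqv_sym oy _; apply: eqv_sym => h th Th hm.
have [hx|hx] := pselect (h x); first exact: (ox _ th Th hx).
by have [hy _] := med_hs (thick_hs th) hm hx; exact: (oy _ th Th hy).
Qed.

End Eqv.

Section Splitting.
Variables T1 T2 : set X -> Prop.
Hypothesis T12 : forall h, thick d h -> T1 h \/ T2 h.
Hypothesis Ttr : forall j k, thick d j -> thick d k -> T1 j -> T2 k -> transverse j k.

Let T1cl j k : thick d j -> thick d k -> T1 j -> ~ transverse j k -> T1 k.
Proof.
by move=> tj tk Tj nt; have [//|Tk] := T12 tk; case: nt; exact: Ttr.
Qed.

Let T2cl j k : thick d j -> thick d k -> T2 j -> ~ transverse j k -> T2 k.
Proof.
by move=> tj tk Tj nt; have [Tk|//] := T12 tk; case: nt; apply: transverseC; exact: Ttr.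
Qed.

Local Notation "x ~1 y" := (eqv T1 x y) (at level 70).
Local Notation "x ~2 y" := (eqv T2 x y) (at level 70).

Let sym1 x y : x ~1 y -> y ~1 x. Proof. exact: (eqv_sym T1cl). Qed.
Let sym2 x y : x ~2 y -> y ~2 x. Proof. exact: (eqv_sym T2cl). Qed.

Lemma eqv_inj x y : x ~1 y -> x ~2 y -> x = y.
Proof.
move=> xy1 xy2; apply: contrapT => /robust_sep[l [hl lx ly]].
have tl := robust_thick hl lx ly.
have lly : l y by apply: contrapT => H; apply: ly; exact: sub_cl.
by have [Tl|Tl] := T12 tl; apply: lx; [exact: (sym1 xy1 tl Tl lly)|exact: (sym2 xy2 tl Tl lly)].
Qed.

(** Compactness applied to [I x y], the closures of type 1 halfspaces around [x] and of type 2
    halfspaces around [y]; the different types meet by transversality. *)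
Lemma corner_exists x y : exists w, [/\ x ~1 w, y ~2 w & I x y w].
Proof.
pose P C := C = I x y \/ exists h, C = cl h /\ thick d h /\
  ((T1 h /\ h x) \/ (T2 h /\ h y)).
have P0 : P (I x y) by left.
have Ph h : thick d h -> (T1 h /\ h x) \/ (T2 h /\ h y) -> P (cl h).
  by move=> ? ?; right; exists h.
have [||||w Hw] := @compact_family cpl {C | P C} sval x (d x y).
- move=> [C PC] /=; case: PC => [->|[h [-> [th _]]]]; first exact: itv_convex.
  by apply: cl_convex; apply: hs_convex; exact: thick_hs.
- by move=> [C PC] /=; case: PC => [->|[h [-> [th _]]]]; [exact: cl_itv|exact: cl_cl].
- have Ih h : (T1 h /\ h x) \/ (T2 h /\ h y) -> I x y `&` cl h !=set0.
    case=> -[_ H]; first by exists x; split; [exact: itvl|exact: sub_cl].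
    by exists y; split; [exact: itvr|exact: sub_cl].
  move=> [C PC] [D PD] /=; case: PC PD => [->|[h [-> [th Hh]]]] [->|[k [-> [tk Hk]]]].
  + by exists x; split; exact: itvl.
  + exact: Ih.
  + by rewrite setIC; exact: Ih.
  + have sub := setISS (@sub_cl h) (@sub_cl k).
    apply: subset_nonempty sub _.
    case: Hh Hk => -[Th hx] [] [Tk kx]; [by exists x| | |by exists y].
      by have [] := Ttr th tk Th Tk.
    by have [] := transverseC (Ttr tk th Tk Th).
- exists (exist _ _ P0) => z /=; rewrite /Defs.interval /=.
  by have := d_ge0 z y; lra.
exists w; split; last exact: (Hw (exist _ _ P0)).
- by move=> h th Th hx; apply: (Hw (exist _ _ (Ph h th _))); left.
- by move=> h th Th hy; apply: (Hw (exist _ _ (Ph h th _))); right.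
Qed.

Lemma corner_itv x y p : x ~1 p -> y ~2 p -> I x y p.
Proof.
move=> xp yp; have [w [xw yw xyw]] := corner_exists x y.
suff <- : w = p by [].
apply: eqv_inj; [apply: (eqv_trans T1cl (y := x))|apply: (eqv_trans T2cl (y := y))] => //.
  exact: sym1.
exact: sym2.
Qed.

(** Each corner lies between its two neighbours; the four equations equate opposite sides. *)
Lemma rectangle a b c e : a ~2 b -> b ~1 c -> c ~2 e -> e ~1 a ->
  d a b = d e c /\ d b c = d a e.
Proof.
move=> ab bc ce ea.
have := corner_itv (sym1 bc) ab; have := corner_itv (sym1 ea) ce.
have := corner_itv ea (sym2 ab); have := corner_itv bc (sym2 ce).
rewrite /Defs.interval /= (dC c b) (dC c a) (dC b a) (dC e a) (dC c e) (dC e b).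
by split; lra.
Qed.

Lemma type_distinct T h : thick d h -> T h -> exists a b, ~ eqv T a b.
Proof.
move=> th Th; have [_ [a ha] [b /interior_not_cl hb]] := th.
exists a, b => H; apply: hb; apply: (H _ th Th).
by have [e [e0 He]] := ha; apply: He; rewrite dxx.
Qed.

Lemma splitting : (exists2 h, thick d h & T1 h) -> (exists2 h, thick d h & T2 h) ->
  ~ irreducible d.
Proof.
move=> [h1 th1 Th1] [h2 th2 Th2]; apply.
have [a1 [b1 ab1]] := type_distinct th1 Th1.
have [a2 [b2 ab2]] := type_distinct th2 Th2.
pose o := a1.
have /choice [z Hz] : forall xy : X * X, exists w,
    [/\ xy.1 ~1 w, xy.2 ~2 w & I xy.1 xy.2 w].
  by move=> [x y]; exact: corner_exists.
have z1 x y : x ~1 z (x, y) by have [] := Hz (x, y).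
have z2 x y : y ~2 z (x, y) by have [] := Hz (x, y).
have zI x y : I x y (z (x, y)) by have [] := Hz (x, y).
pose X1 := {x | o ~2 x}; pose X2 := {x | o ~1 x}.
(* The factors are the two classes of [o], and the coordinates are the corners of [x] with [o]; the
   inverse takes the corner of the coordinates. *)
pose f x : X1 * X2 := (exist _ (z (x, o)) (z2 x o), exist _ (z (o, x)) (z1 o x)).
exists X1, X2, (fun u v : X1 => d (sval u) (sval v)),
  (fun u v : X2 => d (sval u) (sval v)), f.
split.
- exists (fun u : X1 * X2 => z (sval u.1, sval u.2)).
    move=> x /=; apply: eqv_inj.
      apply: (eqv_trans T1cl (y := z (x, o))); [apply: sym1|apply: sym1]; exact: z1.
    by apply: (eqv_trans T2cl (y := z (o, x))); apply: sym2; exact: z2.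
  move=> [[u ou] [v ov]] /=; rewrite /f; congr pair.
    apply: eq_sig_hprop => /= [*|]; first exact: Prop_irrelevance.
    apply: eqv_inj; last by apply: (eqv_trans T2cl (y := o)) => //; apply: sym2; exact: z2.
    by apply: (eqv_trans T1cl (y := z (u, v))); apply: sym1; exact: z1.
  apply: eq_sig_hprop => /= [*|]; first exact: Prop_irrelevance.
  apply: eqv_inj; first by apply: (eqv_trans T1cl (y := o)) => //; apply: sym1; exact: z1.
  by apply: (eqv_trans T2cl (y := z (u, v))); apply: sym2; exact: z2.
(* Split the distance at the corner [w]; each leg is a rectangle side opposite to a coordinate
   distance. *)
- move=> x y /=; pose w := z (x, y).
  have xw : x ~1 w by exact: z1.
  have yw : y ~2 w by exact: z2.
  have := zI x y; rewrite /Defs.interval /= -/w => <-.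
  have z21 u v : z (u, o) ~2 z (v, o).
    by apply: (eqv_trans T2cl (y := o)); [apply: sym2|]; exact: z2.
  have z12 u v : z (o, u) ~1 z (o, v).
    by apply: (eqv_trans T1cl (y := o)); [apply: sym1|]; exact: z1.
  have [_ ->] : d y w = d (z (y, o)) (z (x, o)) /\ d w y = d (z (x, o)) (z (y, o)).
    have [E _] := @rectangle w y (z (y, o)) (z (x, o)) (sym2 yw) (z1 _ _) (z21 _ _)
      (eqv_trans T1cl (sym1 (z1 _ _)) xw).
    by rewrite E dC E dC.
  have [_ ->] := @rectangle (z (o, x)) x w (z (o, y)) (sym2 (z2 _ _)) xw
    (eqv_trans T2cl (sym2 yw) (z2 _ _)) (z12 _ _).
  by rewrite addrC.
- split; apply: median_sub => x y t; [exact: (eqv_med T2cl)|exact: (eqv_med T1cl)].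
- exists (f a1).1, (f b1).1 => -[E]; apply: ab1.
  apply: (eqv_trans T1cl (y := z (a1, o))) => //.
  by rewrite E; apply: sym1; exact: z1.
- exists (f a2).2, (f b2).2 => -[E]; apply: ab2.
  apply: (eqv_trans T2cl (y := z (o, a2))) => //.
  by rewrite E; apply: sym2; exact: z2.
Qed.

End Splitting.

(** * Strong separation *)

Lemma strongly_separatedC (a b : set X) :
  strongly_separated d a b -> strongly_separated d b a.
Proof.
move=> [ha hb H no]; split=> //; first by rewrite setIC.
by case=> j [hj jb ja]; apply: no; exists j.
Qed.

Lemma strongly_separated_disj (a b : set X) : strongly_separated d a b -> a `<=` ~` b.
Proof.
move=> [_ _ H _] x ax bx; suff : set0 x by []; rewrite -H; split; exact: sub_cl.
Qed.

Lemma strongly_separatedS (a b a' b' : set X) : strongly_separated d a b ->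
  halfspace a' -> halfspace b' -> a' `<=` a -> b' `<=` b -> strongly_separated d a' b'.
Proof.
move=> ss ha' hb' aa bb; have ab := strongly_separated_disj ss.
have [_ _ H no] := ss; split => //.
  by apply/seteqP; split=> // x [/(clS aa) ? /(clS bb) ?]; rewrite -H.
case=> j [hj ja jb]; apply: no; exists j; split=> //.
  by apply: (transverse_between ja jb aa) => x /bb bx /ab.
by apply: (transverse_between jb ja bb) => x /aa /ab.
Qed.

Lemma thick_transverse (a b j : set X) : a `<=` ~` b -> halfspace j ->
  transverse j a -> transverse j b ->
  exists l, [/\ thick d l, transverse l a & transverse l b].
Proof.
move=> ab hj [[p [jp ap]] _ [q [jq aq]] _] [[p' [jp' bp']] _ [q' [jq' bq']] _].
have : (hsi q p `&` hsi q' p') j by split; apply/hsiP.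
rewrite hsi_setI => /hsiP[_ j1 j2].
have [l [hl l1 l2]] : exists l, [/\ halfspace l, ~ cl l (med q p q') &
    ~ cl (~` l) (med (med q p q') p p')].
  by apply: robust_sep => E; apply: j1; rewrite E.
have : hsi (med q p q') (med (med q p q') p p') l.
  by apply/hsiP; split=> //; [move/sub_cl|apply: contrapT => /(@sub_cl (~` l))].
rewrite -hsi_setI => -[/hsiP[_ lq lp] /hsiP[_ lq' lp']].
exists l; split; first exact: robust_thick hl l1 l2.
  by split; [exists p|exists p'|exists q|exists q']; split=> // /ab.
by split; [exists p'|exists p|exists q'|exists q]; split=> //; exact: ab.
Qed.

(** By strong separation [h] fails to be transverse to [a0] or [b0]. Up to complements it contains
    that halfspace, and skewering fits a translate of the pair around it, or it lies inside and
    replaces it. *)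
Lemma thick_pair_nested : (exists a b, [/\ thick d a, thick d b & strongly_separated d a b]) ->
  thick_nested_ss d.
Proof.
move=> [a0 [b0 [ta0 tb0 ss0]]].
pose Q h := exists h' c, [/\ h' `<=` h, c `<=` ~` h, thick d h', thick d c &
  strongly_separated d h' c].
have QC h : Q (~` h) -> Q h.
  move=> [h' [c [h'h ch th' tc /strongly_separatedC ss]]]; exists c, h'; split=> //.
  by move: ch; rewrite setCK.
suff HQ h : thick d h -> Q h.
  move=> h /HQ [h' [c [h'h ch th' tc ss]]]; exists h', (~` c); rewrite setCK.
  by split=> // x hx cx; exact: ch hx.
move=> th.
have main a b h1 : thick d a -> thick d b -> strongly_separated d a b -> thick d h1 ->
    ~ transverse a h1 -> Q h1.
  move=> ta tb ss.
  have up k : thick d k -> a `<=` k -> Q k.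
    move=> tk ak; have [g [gka _]] := skewer ta tk ak.
    have kg : k `<=` im (inv g) a by rewrite -(imK g k); exact: image_subset.
    have ss' := im_strongly_separated (inv g) ss.
    exists a, (im (inv g) b); split=> //.
    - by move=> x bx /kg ax; exact: strongly_separated_disj ss' _ ax bx.
    - exact: im_thick.
    - apply: (strongly_separatedS ss') => //; [exact: thick_hs|by case: ss'|].
      exact: subset_trans kg.
  have down k : thick d k -> k `<=` a -> Q k.
    move=> tk ka; exists k, b; split=> //.
      by move=> x bx /ka ax; exact: strongly_separated_disj ss _ ax bx.
    by apply: (strongly_separatedS ss) => //; exact: thick_hs.
  move=> th1 /not_transverse[E|E|E|E].
  - by apply: QC; apply: up; [exact: thickC|move=> x ax hx; rewrite -[False]/(set0 x) -E].
  - apply: up => // x ax; apply: contrapT => hx.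
    by rewrite -[False]/(set0 x) -E.
  - apply: down => // x hx; apply: contrapT => ax.
    by rewrite -[False]/(set0 x) -E.
  - apply: QC; apply: down; first exact: thickC.
    by move=> x hx; apply: contrapT => ax; rewrite -[False]/(set0 x) -E.
have [tra|nta] := pselect (transverse a0 h); last exact: (main a0 b0).
apply: (main b0 a0) => //; first exact: strongly_separatedC.
move=> trb; have [_ _ _ no] := ss0; apply: no; exists h; split; last exact: transverseC.
  exact: thick_hs.
exact: transverseC.
Qed.

Lemma irreducible_thick_pair : irreducible d ->
  exists a b, [/\ thick d a, thick d b & strongly_separated d a b].
Proof.
move=> irr; case: crossing_dichotomy => [[a [b [ab no]]]|[P [eP enP tr]]].
  have [ta tb clab] := ab; exists a, b; split=> //.
  split=> //; [exact: thick_hs|exact: thick_hs|].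
  case=> j [hj ja jb]; have [l] := thick_transverse (sep_pair_disj ab) hj ja jb.
  exact: no.
case: (@splitting P (fun h => ~ P h)) => //.
by move=> h _; have [?|?] := pselect (P h); [left|right].
Qed.

Lemma thick_nested_pair : thick_nested_ss d -> has_strongly_separated_pair d.
Proof.
have [h th] := thick_exists => /(_ h th) [h' [h'' [_ _ _ _ ss]]].
by exists h', (~` h'').
Qed.

End Flip.
End Action.

(** * Halfspaces of products *)
Section Product.
Variables (X1 X2 : Type) (d1 : X1 -> X1 -> R) (d2 : X2 -> X2 -> R).
Variables (c1 : X -> X1) (c2 : X -> X2) (mix : X -> X -> X).
Hypothesis dE : forall x y, d x y = d1 (c1 x) (c1 y) + d2 (c2 x) (c2 y).
Hypothesis d1x : forall a, d1 a a = 0.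
Hypothesis d2x : forall a, d2 a a = 0.
Hypothesis mix1 : forall x y, c1 (mix x y) = c1 x.
Hypothesis mix2 : forall x y, c2 (mix x y) = c2 y.

(** Says that [h] is not a union of fibres of the coordinate [c]. *)
Definition varies {T : Type} (c : X -> T) (h : set X) :=
  exists x y, [/\ h x, ~ h y & c x = c y].

Lemma not_varies_hs T (c : X -> T) h x y :
  ~ varies c h -> c x = c y -> h x -> h y.
Proof. by move=> nv E hx; apply: contrapT => hy; apply: nv; exists x, y. Qed.

(* A halfspace of an l1 product depends on one coordinate only. *)
Lemma varies_once h : halfspace h -> varies c2 h -> varies c1 h -> False.
Proof.
move=> hh [x [y [hx hy xy]]] [z [w [hz hw zw]]].
have H1 : h (mix x w).
  apply: contrapT => hxw; apply: (hs_convexC hh hy hxw _ hx).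
  by rewrite /Defs.interval /= !dE !mix1 !mix2 -xy d1x d2x; lra.
have H2 : ~ h (mix x w).
  move=> hxw; apply: hw; apply: (hs_convex hh hz hxw).
  by rewrite /Defs.interval /= !dE !mix1 !mix2 -zw d1x d2x; lra.
exact: H2.
Qed.

(** A halfspace separating [u] from [v] depends on the second coordinate only, while [h] and [k]
    depend on the first; mixing coordinates fills every sector. *)
Lemma product_transverse h k u v : halfspace h -> halfspace k ->
  ~ varies c1 h -> ~ varies c1 k -> c1 u = c1 v -> u <> v ->
  exists j, [/\ halfspace j, transverse j h & transverse j k].
Proof.
move=> hh hk nh nk uv /sep[j [hj ju jv]].
have nj : ~ varies c2 j by move=> H; apply: (varies_once hj H); exists v, u.
have tr l : halfspace l -> ~ varies c1 l -> transverse j l.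
  move=> [[p lp] [q lq] _ _] nl.
  have jin x : j (mix x v) by apply: (not_varies_hs nj _ jv); rewrite mix2.
  have jout x : ~ j (mix x u).
    by move=> H; apply: ju; apply: (not_varies_hs nj _ H); rewrite mix2.
  have lin x : l (mix p x) by apply: (not_varies_hs nl _ lp); rewrite mix1.
  have lout x : ~ l (mix q x).
    by move=> H; apply: lq; apply: (not_varies_hs nl _ H); rewrite mix1.
  split; [exists (mix p v)|exists (mix q v)|exists (mix p u)|exists (mix q u)].
  - by split; [exact: jin|exact: lin].
  - by split; [exact: jin|exact: lout].
  - by split; [exact: jout|exact: lin].
  - by split; [exact: jout|exact: lout].
by exists j; split=> //; exact: tr.
Qed.

End Product.

Lemma strongly_separated_irreducible : has_strongly_separated_pair d -> irreducible d.
Proof.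
move=> [h [k ss]] [X1 [X2 [d1 [d2 [f [[g fK gK] dE [ms1 ms2] [a1 [b1 ab1]] [a2 [b2 ab2]]]]]]]].
have kh := strongly_separated_disj ss; have [hh hk _ no] := ss.
have [[[e1 s1 _] _] [[e2 s2 _] _]] := (ms1, ms2).
have d1x a : d1 a a = 0 by apply/e1.
have d2x a : d2 a a = 0 by apply/e2.
pose c1 x := (f x).1; pose c2 x := (f x).2.
pose mix x y := g (c1 x, c2 y).
have m1 x y : c1 (mix x y) = c1 x by rewrite /c1 /mix gK.
have m2 x y : c2 (mix x y) = c2 y by rewrite /c2 /mix gK.
have dE' x y : d x y = d2 (c2 x) (c2 y) + d1 (c1 x) (c1 y) by rewrite addrC dE.
have [[p hp] _ _ _] := hh; have [[q kq] _ _ _] := hk.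
have v1 := varies_once dE d1x d2x m1 m2.
(* If both depend on the same coordinate, some halfspace crosses both; if not, a mixed point lies in
   both. *)
have [h1|h1] := pselect (varies c1 h); have [k1|k1] := pselect (varies c1 k).
- apply: no.
  have h2 : ~ varies c2 h by move=> /(v1 h hh); apply.
  have k2 : ~ varies c2 k by move=> /(v1 k hk); apply.
  apply: (@product_transverse X2 X1 d2 d1 c2 c1 (fun x y => mix y x) dE' d2x d1x _ _ _ _
    (g (a1, a2)) (g (b1, a2)) hh hk h2 k2) => //.
    by rewrite /c2 !gK.
  by move=> /(congr1 f); rewrite !gK => -[].
- have h2 : ~ varies c2 h by move=> /(v1 h hh); apply.
  apply: (kh (mix q p)).
    by apply: (not_varies_hs h2 _ hp); rewrite m2.
  by apply: (not_varies_hs k1 _ kq); rewrite m1.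
- have k2 : ~ varies c2 k by move=> /(v1 k hk); apply.
  apply: (kh (mix p q)).
    by apply: (not_varies_hs h1 _ hp); rewrite m1.
  by apply: (not_varies_hs k2 _ kq); rewrite m2.
- apply: no.
  apply: (@product_transverse X1 X2 d1 d2 c1 c2 mix dE d1x d2x m1 m2 _ _
    (g (a1, a2)) (g (a1, b2)) hh hk h1 k1) => //.
    by rewrite /c1 !gK.
  by move=> /(congr1 f); rewrite !gK => -[].
Qed.

End CompleteFiniteRank.
End FiniteRank.
End Separation.
End MedianGeometry.

Theorem theorem5p9 (R : realType) (X : Type) (d : X -> X -> R)
  (G : Type) (mul : G -> G -> G) (one : G) (inv : G -> G) (act : G -> X -> X)
  (nu : set (set X) -> \bar R) :
  median_space d -> complete_space d -> finite_rank d ->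
  isometric_action d mul one inv act ->
  wall_measure d nu ->
  roller_minimal d act nu ->
  without_wall_inversions d act ->
  (irreducible d <-> has_strongly_separated_pair d) /\
  (has_strongly_separated_pair d <-> thick_nested_ss d).
Proof.
move=> ms cpl [n rk] ia wm rm _.
have sep := wall_sep ms wm.
have H12 := irreducible_thick_pair ms sep rk cpl ia wm rm.
have H21 := strongly_separated_irreducible ms sep.
split; split=> //.
- by move=> /H12[a [b [_ _ ?]]]; exists a, b.
(* The detour through irreducibility replaces an arbitrary strongly separated pair by a thick
   one. *)
- move=> /H21/H12; exact: (thick_pair_nested ms sep rk cpl ia wm rm).
- exact: (thick_nested_pair ms sep rk rm).
Qed.
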